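(* Let $A$ be a commutative unital locally convex algebra and $G$ a compact abelian group. A dynamical system $(A,G,\alpha)$ is free if the map $$\mathrm{ev}^{\varphi}_{\chi}:A_{\varphi}\to\mathbb{C},\qquad a\mapsto\chi(a)$$ is surjective for all $\varphi\in\widehat{G}$ and all $\chi\in\Gamma_A$.
   Context: Algebras are complex. A dynamical system $(A,G,\alpha)$ consists of a unital locally convex algebra $A$, a topological group $G$ and a group homomorphism $\alpha:G\to\mathrm{Aut}(A)$ such that the action map $G\times A\to A$ is continuous. $\Gamma_A:=\mathrm{Hom}_{\mathrm{alg}}(A,\mathbb{C})\setminus\{0\}$ is the spectrum of $A$. $\widehat{G}$ is the (continuous) character group of $G$, and for $\varphi\in\widehat{G}$ the isotypic component is $A_{\varphi}:=\{a\in A:\ \alpha(g)(a)=\varphi(g)\cdot a\ \text{for all } g\in G\}$. A family $(\pi_j,V_j)_{j\in J}$ of (continuous) representations of $G$ is point separating if for each $g\neq 1_G$ there is $j\in J$ with $\pi_j(g)\neq\mathrm{id}_{V_j}$. For a representation $(\pi,V)$ of $G$ put $$\Gamma_A V:=(A\otimes V)^G=\{s\in A\otimes V:\ (\alpha(g)\otimes\pi(g))(s)=s\ \text{for all } g\in G\}.$$ A dynamical system $(A,G,\alpha)$ with $A$ commutative is called free if there exists a point separating family $(\pi_j,V_j)_{j\in J}$ of representations of $G$ such that for all $j\in J$ and all $\chi\in\Gamma_A$ the map $\Gamma_A V_j\to V_j$, $a\otimes v\mapsto\chi(a)\cdot v$ (the restriction of $\chi\otimes\mathrm{id}_{V_j}$)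 is surjective. *)

(* Defs.v *)
From HB Require Import structures.
From mathcomp Require Import all_boot all_order all_algebra.
From mathcomp Require Import generic_quotient.
From mathcomp Require Import all_classical all_reals all_analysis.

Set Implicit Arguments.
Unset Strict Implicit.
Unset Printing Implicit Defensive.

Import Order.TTheory GRing.Theory Num.Theory.
Import numFieldNormedType.Exports.

Local Open Scope quotient_scope.
Local Open Scope classical_set_scope.
Local Open Scope ring_scope.

(* Algebraic tensor product of two K-modules: finite formal sums of symbols
   u (x) v, represented by sequences of pairs, modulo the congruence generated
   by commutativity of the sum and the bilinearity relations.  [tensor_liftE]
   and [tensor_ind] amount to its universal property. *)
Section TensorProduct.
Context (K : numFieldType) (U V : lmodType K).
Implicit Types s t : seq (U * V).

Inductive tensor_rel : seq (U * V) -> seq (U * V) -> Prop :=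
| tensor_rel_refl s : tensor_rel s s
| tensor_rel_sym s t : tensor_rel s t -> tensor_rel t s
| tensor_rel_trans s t r : tensor_rel s t -> tensor_rel t r -> tensor_rel s r
| tensor_rel_cat s s' t t' :
    tensor_rel s s' -> tensor_rel t t' -> tensor_rel (s ++ t) (s' ++ t')
| tensor_relC s t : tensor_rel (s ++ t) (t ++ s)
| tensor_rel0 v : tensor_rel [:: (0, v)] [::]
| tensor_relDl u u' v : tensor_rel [:: (u + u', v)] [:: (u, v); (u', v)]
| tensor_relDr u v v' : tensor_rel [:: (u, v + v')] [:: (u, v); (u, v')]
| tensor_relZ a u v : tensor_rel [:: (a *: u, v)] [:: (u, a *: v)].

Definition tensor_eq : rel (seq (U * V)) := fun s t => `[< tensor_rel s t >].

Fact tensor_eq_refl : reflexive tensor_eq.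
Proof. by move=> s; apply/asboolP; exact: tensor_rel_refl. Qed.

Fact tensor_eq_sym : symmetric tensor_eq.
Proof.
by move=> s t; apply/asboolP/asboolP => st; exact: tensor_rel_sym.
Qed.

Fact tensor_eq_trans : transitive tensor_eq.
Proof.
by move=> t s r /asboolP st /asboolP tr; apply/asboolP;
  exact: tensor_rel_trans st tr.
Qed.

Canonical tensor_equiv :=
  EquivRel tensor_eq tensor_eq_refl tensor_eq_sym tensor_eq_trans.

Definition tensor := {eq_quot tensor_equiv}.
HB.instance Definition _ := Choice.on tensor.
HB.instance Definition _ := EqQuotient.on tensor.

Definition tensor_pi s : tensor := \pi_tensor s.

Lemma tensor_piP s t : tensor_pi s = tensor_pi t <-> tensor_rel s t.
Proof.
split; first by move=> /eqmodP/asboolP.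
by move=> st; apply/eqmodP/asboolP.
Qed.

Lemma tensor_reprP s : tensor_rel (repr (tensor_pi s)) s.
Proof. by apply/tensor_piP; rewrite /tensor_pi reprK. Qed.

Definition tensor_scale_seq (a : K) s := [seq (a *: p.1, p.2) | p <- s].

Fact tensor_scale_rel a s t :
  tensor_rel s t -> tensor_rel (tensor_scale_seq a s) (tensor_scale_seq a t).
Proof.
elim=> {s t} /=.
- by move=> s; exact: tensor_rel_refl.
- by move=> s t _; exact: tensor_rel_sym.
- by move=> s t r _ st _; exact: tensor_rel_trans.
- move=> s s' t t' _ ss' _ tt'; rewrite /tensor_scale_seq !map_cat.
  exact: tensor_rel_cat.
- by move=> s t; rewrite /tensor_scale_seq !map_cat; exact: tensor_relC.
- by move=> v; rewrite scaler0; exact: tensor_rel0.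
- by move=> u u' v; rewrite scalerDr; exact: tensor_relDl.
- by move=> u v v'; exact: tensor_relDr.
- move=> b u v; rewrite scalerA mulrC -scalerA; exact: tensor_relZ.
Qed.

Definition tensor_zero : tensor := tensor_pi [::].
Definition tensor_add (x y : tensor) : tensor := tensor_pi (repr x ++ repr y).
Definition tensor_scale (a : K) (x : tensor) : tensor :=
  tensor_pi (tensor_scale_seq a (repr x)).
Definition tensor_opp (x : tensor) : tensor := tensor_scale (-1) x.

Fact tensor_addE s t :
  tensor_add (tensor_pi s) (tensor_pi t) = tensor_pi (s ++ t).
Proof. by apply/tensor_piP/tensor_rel_cat; exact: tensor_reprP. Qed.

Fact tensor_scaleE a s :
  tensor_scale a (tensor_pi s) = tensor_pi (tensor_scale_seq a s).
Proof. by apply/tensor_piP/tensor_scale_rel; exact: tensor_reprP. Qed.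

Fact tensor_surj (P : tensor -> Prop) :
  (forall s, P (tensor_pi s)) -> forall x, P x.
Proof. by move=> Ps x; rewrite -[x]reprK; exact: Ps. Qed.

Fact tensor_addA : associative tensor_add.
Proof.
elim/tensor_surj => s; elim/tensor_surj => t; elim/tensor_surj => r.
by rewrite !tensor_addE catA.
Qed.

Fact tensor_addC : commutative tensor_add.
Proof.
elim/tensor_surj => s; elim/tensor_surj => t; rewrite !tensor_addE.
by apply/tensor_piP; exact: tensor_relC.
Qed.

Fact tensor_add0 : left_id tensor_zero tensor_add.
Proof. by elim/tensor_surj => s; rewrite tensor_addE. Qed.

Fact tensor_scaleDl x a b :
  tensor_scale (a + b) x = tensor_add (tensor_scale a x) (tensor_scale b x).
Proof.
elim/tensor_surj: x => s; rewrite !tensor_scaleE tensor_addE.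
apply/tensor_piP; elim: s => [|[u v] s IHs] /=; first exact: tensor_rel_refl.
rewrite scalerDl; set p := (a *: u, v); set q := (b *: u, v).
set sa := tensor_scale_seq a s in IHs *; set sb := tensor_scale_seq b s in IHs *.
apply: (@tensor_rel_trans _ ([:: p; q] ++ (sa ++ sb))).
  by rewrite -cat1s; apply: tensor_rel_cat IHs; exact: tensor_relDl.
have -> : [:: p; q] ++ (sa ++ sb) = [:: p] ++ (([:: q] ++ sa) ++ sb) by [].
have -> : p :: sa ++ q :: sb = [:: p] ++ ((sa ++ [:: q]) ++ sb) by rewrite -catA.
apply: tensor_rel_cat; first exact: tensor_rel_refl.
by apply: tensor_rel_cat; [exact: tensor_relC|exact: tensor_rel_refl].
Qed.

Fact tensor_scale0 x : tensor_scale 0 x = tensor_zero.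
Proof.
elim/tensor_surj: x => s; rewrite tensor_scaleE; apply/tensor_piP.
elim: s => [|[u v] s IHs] /=; first exact: tensor_rel_refl.
rewrite scale0r -cat1s -[X in tensor_rel _ X]cats0.
by apply: tensor_rel_cat IHs; exact: tensor_rel0.
Qed.

Fact tensor_scale1 : left_id 1 tensor_scale.
Proof.
elim/tensor_surj => s; rewrite tensor_scaleE; congr tensor_pi.
by elim: s => [//|[u v] s /= ->]; rewrite scale1r.
Qed.

Fact tensor_scaleA a b x :
  tensor_scale a (tensor_scale b x) = tensor_scale (a * b) x.
Proof.
elim/tensor_surj: x => s; rewrite !tensor_scaleE; congr tensor_pi.
by elim: s => [//|[u v] s /= ->]; rewrite scalerA.
Qed.

Fact tensor_scaleDr : right_distributive tensor_scale tensor_add.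
Proof.
move=> a; elim/tensor_surj => s; elim/tensor_surj => t.
by rewrite !(tensor_scaleE, tensor_addE) /tensor_scale_seq map_cat.
Qed.

Fact tensor_addN : left_inverse tensor_zero tensor_opp tensor_add.
Proof.
move=> x; rewrite /tensor_opp -[X in tensor_add _ X]tensor_scale1.
by rewrite -tensor_scaleDl addNr tensor_scale0.
Qed.

HB.instance Definition _ := GRing.isZmodule.Build tensor
  tensor_addA tensor_addC tensor_add0 tensor_addN.

HB.instance Definition _ := GRing.Zmodule_isLmodule.Build K tensor
  tensor_scaleA tensor_scale1 tensor_scaleDr tensor_scaleDl.

Definition tpure (u : U) (v : V) : tensor := tensor_pi [:: (u, v)].

Lemma tensor_piE s : tensor_pi s = \sum_(p <- s) tpure p.1 p.2.
Proof.
elim: s => [|[u v] s IHs]; first by rewrite big_nil.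
by rewrite big_cons -IHs [RHS]tensor_addE.
Qed.

Lemma tensor_ind (P : tensor -> Prop) : P 0 ->
  (forall u v x, P x -> P (tpure u v + x)) -> forall x, P x.
Proof.
move=> P0 PD; elim/tensor_surj=> s; elim: s => [|[u v] s IHs]; first exact: P0.
have -> : tensor_pi ((u, v) :: s) = tpure u v + tensor_pi s.
  by rewrite [RHS]tensor_addE.
exact: PD.
Qed.

Lemma tpureDl v : {morph tpure^~ v : u u' / u + u'}.
Proof.
move=> u u'; rewrite [RHS]tensor_addE.
by apply/tensor_piP; exact: tensor_relDl.
Qed.

Lemma tpureDr u : {morph tpure u : v v' / v + v'}.
Proof.
move=> v v'; rewrite [RHS]tensor_addE.
by apply/tensor_piP; exact: tensor_relDr.
Qed.

Lemma tpureZl a u v : tpure (a *: u) v = a *: tpure u v.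
Proof. by rewrite [RHS]tensor_scaleE. Qed.

Lemma tpureZr a u v : tpure u (a *: v) = a *: tpure u v.
Proof.
by rewrite -tpureZl; apply/tensor_piP/tensor_rel_sym; exact: tensor_relZ.
Qed.

Section Lift.
Context (W : lmodType K) (B : U -> V -> W).

(* Only meaningful when B is bilinear. *)
Definition tensor_lift (x : tensor) : W := \sum_(p <- repr x) B p.1 p.2.

Hypothesis Bl : forall v, linear (B^~ v).
Hypothesis Br : forall u, linear (B u).

Let B_rel s t : tensor_rel s t ->
  \sum_(p <- s) B p.1 p.2 = \sum_(p <- t) B p.1 p.2.
Proof.
have Bl0 v : B 0 v = 0 by have := Bl v (-1) 0 0; rewrite scaler0 addr0 scaleN1r addNr.
have Br0 u : B u 0 = 0 by have := Br u (-1) 0 0; rewrite scaler0 addr0 scaleN1r addNr.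
elim=> {s t} //=.
- by move=> s t r _ -> _ ->.
- by move=> s s' t t' _ ss' _ tt'; rewrite !big_cat /= ss' tt'.
- by move=> s t; rewrite !big_cat /= addrC.
- by move=> v; rewrite big_seq1 big_nil Bl0.
- move=> u u' v; rewrite big_seq1 big_cons big_seq1 /=.
  by have := Bl v 1 u u'; rewrite !scale1r.
- move=> u v v'; rewrite big_seq1 big_cons big_seq1 /=.
  by have := Br u 1 v v'; rewrite !scale1r.
- move=> a u v; rewrite !big_seq1 /=.
  have := Bl v a u 0; rewrite !addr0 Bl0 addr0 => ->.
  by have := Br u a v 0; rewrite !addr0 Br0 addr0 => ->.
Qed.

Lemma tensor_liftE u v : tensor_lift (tpure u v) = B u v.
Proof. by rewrite /tensor_lift (B_rel (tensor_reprP _)) big_seq1. Qed.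

Lemma tensor_lift_is_linear : linear tensor_lift.
Proof.
move=> a; elim/tensor_surj => s; elim/tensor_surj => t.
have -> : a *: tensor_pi s + tensor_pi t = tensor_pi (tensor_scale_seq a s ++ t).
  by rewrite -tensor_addE -tensor_scaleE.
rewrite /tensor_lift !(B_rel (tensor_reprP _)) big_cat /= scaler_sumr big_map /=.
congr (_ + _); apply: eq_bigr => -[u v] _ /=.
have := Bl v a u 0; rewrite addr0 => ->.
by have := Bl v (-1) 0 0; rewrite scaler0 addr0 scaleN1r addNr => ->; rewrite addr0.
Qed.

End Lift.
End TensorProduct.

Definition tensor_map (K : numFieldType) (U V U' V' : lmodType K)
    (f : U -> U') (h : V -> V') : tensor U V -> tensor U' V' :=
  tensor_lift (fun u v => tpure (f u) (h v)).

HB.mixin Record isTopologicalGroup G & Topological G & Group G := {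
  mulg_continuous : continuous (fun x : G * G => (x.1 * x.2)%g);
  invg_continuous : continuous (fun x : G => (x^-1)%g)
}.

#[short(type="topologicalGroupType")]
HB.structure Definition TopologicalGroup :=
  {G of isTopologicalGroup G & Topological G & Group G}.

(* As in the algebraic hierarchy, unital algebras satisfy 1 != 0. *)
HB.mixin Record isLocallyConvexAlgebra (K : numDomainType) A
    & Tvs K A & GRing.Algebra K A := {
  lcalg_mul_continuous : continuous (fun x : A * A => x.1 * x.2)
}.

#[short(type="locallyConvexAlgType")]
HB.structure Definition LocallyConvexAlgebra (K : numDomainType) :=
  {A of isLocallyConvexAlgebra K A & Tvs K A & GRing.Algebra K A}.

Section DynamicalSystem.
Context (K : numFieldType) (A : locallyConvexAlgType K)
  (G : topologicalGroupType).

(* Since [ds_act 1 = id] and [ds_act] is multiplicative, every [ds_act g] is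
   bijective, hence an automorphism of A. *)
Record dynamical_system := DynamicalSystem {
  ds_act :> G -> {lrmorphism A -> A};
  ds_act1 : forall a, ds_act 1%g a = a;
  ds_actM : forall g h a, ds_act (g * h)%g a = ds_act g (ds_act h a);
  ds_continuous : continuous (fun x : G * A => ds_act x.1 x.2)
}.

(* Characters of A are not required to be continuous. *)
Definition spectrum : set {scalar A} :=
  [set chi : {scalar A} | {morph chi : a b / a * b} /\ exists a, chi a != 0].

Definition character_group : set (G -> K^o) :=
  [set phi : G -> K^o | [/\ continuous phi, forall g, `|phi g| = 1
                        & forall g h, phi (g * h)%g = phi g * phi h]].

Definition isotypic (alpha : dynamical_system) (phi : G -> K^o) : set A :=
  [set a | forall g, alpha g a = phi g *: a].

(* Hausdorff, as otherwise an indiscrete space would void continuity. *)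
Record representation := Representation {
  rep_space : tvsType K;
  rep_hausdorff : hausdorff_space rep_space;
  rep_act :> G -> {linear rep_space -> rep_space};
  rep_act1 : forall v, rep_act 1%g v = v;
  rep_actM : forall g h v, rep_act (g * h)%g v = rep_act g (rep_act h v);
  rep_continuous : continuous (fun x : G * rep_space => rep_act x.1 x.2)
}.

Definition point_separating (J : Type) (pi : J -> representation) :=
  forall g : G, g != 1%g -> exists j, exists v, pi j g v <> v.

Definition sections (alpha : dynamical_system) (pi : representation) :
    set (tensor A (rep_space pi)) :=
  [set s | forall g, tensor_map (alpha g) (pi g) s = s].

Definition tensor_eval (chi : {scalar A}) (V : lmodType K) : tensor A V -> V :=
  tensor_lift (fun a v => chi a *: v).

Definition free_system (alpha : dynamical_system) :=
  exists (J : Type) (pi : J -> representation),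
    point_separating pi /\
    forall j chi, spectrum chi ->
      set_surj (@sections alpha (pi j)) [set: rep_space (pi j)]
        (tensor_eval chi (V := rep_space (pi j))).

End DynamicalSystem.

Arguments dynamical_system {K} A G.
Arguments spectrum {K} A.
Arguments character_group : clear implicits.
Arguments representation : clear implicits.
Arguments sections {K A G} alpha pi.

(* Main.v *)
Require Import Defs.
From HB Require Import structures.
From mathcomp Require Import all_boot all_order all_algebra.
From mathcomp Require Import all_classical all_reals all_analysis.
From mathcomp Require Import complex.
From mathcomp Require Import ring lra.

(** The point separating family consists of all characters phi of G, each seen as
    a representation of G on the complex line. For such a line the map from
    sections to the fibre is surjective because a (x) 1 is an invariant section
    whenever a lies in the isotypic component of the inverse of phi, and the
    evaluation of that component at chi is surjective by hypothesis
    ([tensor_mapE], [tensor_evalE]).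

    What has to be proved is that the continuous characters of a compact abelian
    Hausdorff group separate its points
    ([compact_abelian_characters_separate]). The argument is a form of the
    Peter-Weyl theorem that works with elementary means.

    - Integration. An abelian group is amenable: averages over larger and larger
      boxes of products of powers are more and more invariant, and an ultrafilter
      limit of them is an invariant mean on bounded functions
      ([abelian_group_amenable]). On continuous functions on a compact group
      this mean is faithful and satisfies Fubini's theorem ([mean_faithful],
      [mean_fubini]). So the continuous functions form a commutative algebra
      under convolution, with an involution and an L2 norm.

    - Spectral theory. For a nonzero self-adjoint k, the normalised powers of
      k * k converge uniformly to a nonzero self-adjoint idempotent q such that
      k * k * q = lam q with lam > 0 ([power_method]). This takes the place of
      the spectral theorem for compact operators.

    - Characters. A nonzero self-adjoint idempotent takes a value at least 1 at
      the identity, so there is a minimal one p below any given one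
      ([minimal_idem_exists]). By the previous point the ideal generated by a
      minimal p has dimension 1; it is stable under translations, so p is an
      eigenvector of all of them, and its eigenvalues form a character
      ([minimal_idem_character]).

    - Separation. If f is not invariant under z, start from
      k = d * star d with d = f - translate z f. The character obtained below the
      corresponding idempotent cannot be trivial at z
      ([character_separates]). *)

Set Implicit Arguments.
Unset Strict Implicit.
Unset Printing Implicit Defensive.
Import Order.TTheory GRing.Theory Num.Theory.
Import numFieldNormedType.Exports.
Local Open Scope classical_set_scope.
Local Open Scope ring_scope.

(** * Bounded functions *)

Definition bdd (K : numDomainType) (T : Type) (f : T -> K) :=
  exists B : K, forall x, `|f x| <= B.

Section Bounded.
Context (K : numDomainType) (T : Type).
Implicit Types f h : T -> K.

Lemma bdd_cst (c : K) : bdd (fun _ : T => c).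
Proof. by exists `|c|. Qed.

Lemma bddD f h : bdd f -> bdd h -> bdd (fun x => f x + h x).
Proof.
move=> [B fB] [B' hB]; exists (B + B') => x.
by rewrite (le_trans (ler_normD _ _))// lerD.
Qed.

Lemma bddM f h : bdd f -> bdd h -> bdd (fun x => f x * h x).
Proof.
move=> [B fB] [B' hB]; exists (B * B') => x.
by rewrite normrM ler_pM.
Qed.

Lemma bddN f : bdd f -> bdd (fun x => - f x).
Proof. by move=> [B fB]; exists B => x; rewrite normrN. Qed.

Lemma bdd_comp (S : Type) f (r : S -> T) : bdd f -> bdd (fun x => f (r x)).
Proof. by move=> [B fB]; exists B. Qed.
End Bounded.

Lemma bdd_conj (K : numClosedFieldType) (T : Type) (f : T -> K) :
  bdd f -> bdd (fun x => (f x)^*).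
Proof. by move=> [B fB]; exists B => x; rewrite norm_conjC. Qed.

(** * Invariant means on abelian groups *)

(** The limit along an ultrafilter finer than [F]: it exists for every bounded
    function because segments are compact, and it agrees with the limit along
    [F] whenever the latter exists. *)
Lemma ultrafilter_limit (R : realType) (I : Type) (F : set_system I) :
  ProperFilter F ->
  exists L : (I -> R) -> R,
  [/\ forall a f h, bdd f -> bdd h ->
        L (fun i => a * f i + h i) = a * L f + L h,
      forall f, bdd f -> (forall i, 0 <= f i) -> 0 <= L f
    & forall f l, f @ F --> l -> L f = l].
Proof.
move=> FF; have [U [UU FU]] := ultraFilterLemma FF.
have cv (f : I -> R) : bdd f -> cvg (f @ U).
  move=> [B fB]; pose V : set_system R := f @ U.
  have VU : UltraFilter V.
    split; first exact: fmap_proper_filter.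
    move=> W WF VW; apply/seteqP; split=> [A WA|A]; last exact: VW.
    have [//|UA] := in_ultra_setVsetC (f @^-1` A) UU.
    have WCA : W (~` A) by apply: VW.
    have : W set0 by rewrite -(setICr A); exact: filterI.
    by move/filter_not_empty.
  have := @segment_compact R (- B) B.
  rewrite compact_ultra => /(_ V VU) [|l [_ Vl]]; last by apply/cvg_ex; exists l.
  apply: (@filterS _ U _ setT) => [i _|]; last exact: filterT.
  by rewrite /= in_itv /= -ler_norml fB.
exists (fun f => lim (f @ U)); split.
- move=> a f h bf bh.
  apply/cvg_lim; first exact: norm_hausdorff.
  by apply: cvgD; [apply: cvgMr|]; apply: cv.
- move=> f bf f0; apply: limr_ge; first exact: cv.
  exact: filterS filterT.
- move=> f l fl; apply/cvg_lim; first exact: norm_hausdorff.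
  by move=> A /fl; exact: FU.
Qed.

Section BoxAverages.
Context (R : realType) (G : groupType).
Context (GC : commutative (@monoid.mul G)).
Implicit Types (f h : G -> R) (s : seq G) (n : nat).

Definition powers_avg n f (g : G) : G -> R :=
  fun x => (\sum_(k < n.+1) f (g ^+ k * x)%g) / n.+1%:R.

(** The average of [f] over the translates of a point by the box of the products
    of g ^+ k_g with g in [s] and each k_g at most [n], counted with
    multiplicity; such boxes form a Folner net. *)
Definition box_avg n s f : G -> R := foldr (fun g F => powers_avg n F g) f s.

Lemma box_avg_linear n s a f h :
  box_avg n s (fun x => a * f x + h x) =
  (fun x => a * box_avg n s f x + box_avg n s h x).
Proof.
elim: s => //= g s ->; apply/funext => x.
by rewrite /powers_avg big_split/= -mulr_sumr mulrDl mulrA.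
Qed.

Lemma box_avg_cst n s (c : R) : box_avg n s (fun=> c) = fun=> c.
Proof.
elim: s => //= g s ->; apply/funext => x; rewrite /powers_avg sumr_const card_ord.
by rewrite -[c *+ _]mulr_natr mulfK// pnatr_eq0.
Qed.

Lemma box_avg_ge0 n s f : (forall x, 0 <= f x) -> forall x, 0 <= box_avg n s f x.
Proof.
move=> f0; elim: s => //= g s IH x.
by rewrite divr_ge0// sumr_ge0.
Qed.

Lemma box_avg_le n s f B :
  (forall x, `|f x| <= B) -> forall x, `|box_avg n s f x| <= B.
Proof.
move=> fB x; rewrite ler_norml.
have H a : (a * box_avg n s f x + B) = box_avg n s (fun x => a * f x + B) x.
  by rewrite (box_avg_linear n s a f (fun=> B)) box_avg_cst.
apply/andP; split.
  rewrite -subr_ge0 opprK -[box_avg n s f x]mul1r H; apply: box_avg_ge0 => y.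
  by rewrite mul1r -lerBlDr sub0r; have := fB y; rewrite ler_norml => /andP[].
rewrite -subr_ge0 addrC -mulN1r H; apply: box_avg_ge0 => y.
by rewrite mulN1r addrC subr_ge0; have := fB y; rewrite ler_norml => /andP[].
Qed.

Lemma box_avg_translate n s f g :
  box_avg n s (fun x => f (g * x)%g) = fun x => box_avg n s f (g * x)%g.
Proof.
elim: s => //= h s ->; apply/funext => x; congr (_ / _).
by apply: eq_bigr => k _; rewrite !mulgA [(g * _)%g]GC.
Qed.

(** Translating by a member g of [s] shifts the sum over the powers of g by one
    step, so that only the two end terms survive in the difference; the averages
    over the other members of [s] are contractions that commute with
    translations. *)
Lemma box_avg_almost_invariant n s f g B : (forall x, `|f x| <= B) -> g \in s ->
  forall x, `|box_avg n s f (g * x)%g - box_avg n s f x| <= 2 * B / n.+1%:R.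
Proof.
move=> fB; have n0 : 0 < n.+1%:R :> R by rewrite ltr0n.
elim: s => //= h s IH; rewrite inE => /predU1P[<-|gs] x; rewrite /powers_avg.
  set F := box_avg n s f.
  have FB y : `|F y| <= B by exact: box_avg_le.
  rewrite -mulrBl -sumrB normrM [X in _ * X]ger0_norm ?invr_ge0 ?(ltW n0)//.
  rewrite ler_pM2r ?invr_gt0//.
  under eq_bigr do rewrite mulgA -expgSr.
  have := @telescope_sumr _ 0 n.+1 (fun k => F (g ^+ k * x)%g) isT.
  rewrite big_mkord => ->; rewrite (le_trans (ler_normB _ _))//.
  by rewrite mulr2n mulrDl mul1r lerD.
rewrite -mulrBl -sumrB normrM [X in _ * X]ger0_norm ?invr_ge0 ?(ltW n0)//.
rewrite ler_pdivrMr// (le_trans (ler_norm_sum _ _ _))//.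
apply: (@le_trans _ _ (\sum_(i < n.+1) 2 * B / n.+1%:R)).
  by apply: ler_sum => k _; rewrite mulgA [(_ * g)%g]GC -mulgA IH.
by rewrite sumr_const card_ord mulr_natr.
Qed.

Definition box_filter : set_system (seq G * nat) :=
  [set P | exists s n, forall i : seq G * nat, {subset s <= i.1} -> (n <= i.2)%N -> P i].

Lemma box_filter_proper : ProperFilter box_filter.
Proof.
split.
  by move=> [s [n H]]; apply: (H (s, n)).
split.
- by exists [::], 0%N.
- move=> P Q [s [n sn]] [t [m tm]]; exists (s ++ t), (maxn n m) => i st nm; split.
    apply: sn; last by apply: leq_trans nm; exact: leq_maxl.
    by move=> x xs; apply: st; rewrite mem_cat xs.
  apply: tm; last by apply: leq_trans nm; exact: leq_maxr.
  by move=> x xs; apply: st; rewrite mem_cat xs orbT.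
- by move=> P Q PQ [s [n H]]; exists s, n => i si ni; apply/PQ/H.
Qed.

(** Abelian groups are amenable. The mean is a generalised limit of box averages,
    symmetrised under inversion: as inversion turns translations into
    translations, the symmetrised functional is still translation invariant. *)
Lemma abelian_group_amenable : exists M : (G -> R) -> R,
  [/\ forall a f h, bdd f -> bdd h ->
        M (fun x => a * f x + h x) = a * M f + M h,
      forall f, bdd f -> (forall x, 0 <= f x) -> 0 <= M f,
      M (fun=> 1) = 1,
      forall f g, bdd f -> M (fun x => f (g * x)%g) = M f
    & forall f, M (fun x => f (x^-1)%g) = M f].
Proof.
have FF := box_filter_proper.
have [L [Llin Lge0 Llim]] := @ultrafilter_limit R _ _ FF.
pose A f (i : seq G * nat) := box_avg i.2 i.1 f 1%g.
have bA f : bdd f -> bdd (A f).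
  by move=> [B fB]; exists B => i; exact: box_avg_le.
pose M f := L (A f).
have Mlin a f h : bdd f -> bdd h -> M (fun x => a * f x + h x) = a * M f + M h.
  move=> bf bh; rewrite /M -Llin; [|exact: bA..].
  by congr L; apply/funext => i; rewrite /A box_avg_linear.
have Mge0 f : bdd f -> (forall x, 0 <= f x) -> 0 <= M f.
  by move=> bf f0; apply: Lge0 => [|i]; [exact: bA|exact: box_avg_ge0].
have M1 : M (fun=> 1) = 1.
  apply: Llim; rewrite /A.
  under eq_fun do rewrite box_avg_cst.
  exact: cvg_cst.
have btr f g : bdd f -> bdd (fun x => f (g * x)%g).
  by move=> [B fB]; exists B.
have Mtr f g : bdd f -> M (fun x => f (g * x)%g) = M f.
  move=> bf; have [B fB] := bf; apply/subr0_eq; rewrite addrC -mulN1r -Llin.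
  - apply: Llim; apply/cvgrPdist_le => e e0.
    exists [:: g], (Num.truncn (2 * B / e)) => -[s n] /= gs en.
    rewrite sub0r normrN mulN1r addrC /A/= box_avg_translate.
    apply: le_trans (box_avg_almost_invariant _ fB _ _) _.
      by apply: gs; rewrite inE.
    have B0 : 0 <= B by apply: le_trans (fB 1%g).
    rewrite ler_pdivrMr ?ltr0n// [e * _]mulrC -ler_pdivrMr//.
    by rewrite (le_trans (ltW (truncnS_gt _)))// ler_nat ltnS.
  - exact: bA.
  - exact/bA/btr.
have bV f : bdd f -> bdd (fun x => f (x^-1)%g) by move=> [B fB]; exists B.
exists (fun f => (M f + M (fun x => f (x^-1)%g)) / 2); split.
- move=> a f h bf bh; rewrite Mlin// (Mlin a (fun x => f _))//; [|exact: bV..].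
  by field.
- by move=> f bf f0; rewrite divr_ge0// addr_ge0// Mge0//; exact: bV.
- by rewrite !M1; field.
- move=> f g bf; rewrite Mtr//; congr ((_ + _) / _).
  rewrite -(Mtr (fun x => f (x^-1)%g) (g^-1)%g); last exact: bV.
  by congr M; apply/funext => x; rewrite GC invgM invgK GC. 
- move=> f; rewrite addrC; congr ((M _ + _) / _).
  by apply/funext => x; rewrite invgK.
Qed.
End BoxAverages.

(** Linearity, positivity and invariance under translations are only required on
    bounded functions, since a generalised limit is meaningless elsewhere. Boundedness rather than
    continuity is the right domain: the proof of the Fubini property evaluates
    the mean on indicator functions. *)
Record invariant_mean (C : numClosedFieldType) (G : groupType)
    (M : (G -> C) -> C) : Prop := InvariantMean {
  mean_linear : forall a f h, bdd f -> bdd h ->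
    M (fun x => a * f x + h x) = a * M f + M h;
  mean_ge0 : forall f, bdd f -> (forall x, 0 <= f x) -> 0 <= M f;
  mean1 : M (fun=> 1) = 1;
  mean_conj : forall f, bdd f -> M (fun x => (f x)^*) = (M f)^*;
  mean_translate : forall f g, bdd f -> M (fun x => f (g * x)%g) = M f;
  mean_inv : forall f, M (fun x => f (x^-1)%g) = M f }.

Lemma complex_invariant_mean (R : realType) (G : groupType) :
  commutative (@monoid.mul G) ->
  exists M : (G -> R[i]) -> R[i], invariant_mean M.
Proof.
move=> GC; have [M [Mlin Mge0 M1 Mtr MV]] := @abelian_group_amenable R G GC.
have bRe (f : G -> R[i]) : bdd f -> bdd (fun x => complex.Re (f x)).
  move=> [B fB]; exists (complex.Re B) => x.
  have := fB x; rewrite normc_def lecE => /andP[_]; apply: le_trans.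
  by rewrite -sqrtr_sqr ler_wsqrtr// lerDl sqr_ge0.
have bIm (f : G -> R[i]) : bdd f -> bdd (fun x => complex.Im (f x)).
  move=> [B fB]; exists (complex.Re B) => x.
  have := fB x; rewrite normc_def lecE => /andP[_]; apply: le_trans.
  by rewrite -sqrtr_sqr ler_wsqrtr// lerDr sqr_ge0.
have M0 : M (fun=> 0) = 0.
  have b1 : bdd (fun _ : G => 1 : R) by exists 1 => x; rewrite normr1.
  by have := Mlin (-1) _ _ b1 b1; rewrite M1 mulN1r addNr.
have M0' : bdd (fun _ : G => 0 : R) by exists 0 => x; rewrite normr0.
have Mbdd a f : bdd f -> bdd (fun x : G => a * f x : R).
  move=> [B fB]; exists (`|a| * B) => x; rewrite normrM ler_wpM2l//.
have MZ a f : bdd f -> M (fun x => a * f x) = a * M f.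
  move=> bf; rewrite -[RHS]addr0 -M0 -Mlin//.
  by congr M; apply/funext => x; rewrite addr0.
exists (fun f => M (fun x => complex.Re (f x)) +i* M (fun x => complex.Im (f x)))%C.
split => /=.
- move=> a f h bf bh.
  have bDRe : bdd (fun x => - complex.Im a * complex.Im (f x) + complex.Re (h x)).
    have [B fB] := Mbdd (- complex.Im a) _ (bIm _ bf); have [B' hB] := bRe _ bh.
    by exists (B + B') => x; rewrite (le_trans (ler_normD _ _))// lerD.
  have bDIm : bdd (fun x => complex.Im a * complex.Re (f x) + complex.Im (h x)).
    have [B fB] := Mbdd (complex.Im a) _ (bRe _ bf); have [B' hB] := bIm _ bh.
    by exists (B + B') => x; rewrite (le_trans (ler_normD _ _))// lerD.
  have -> : (fun x => complex.Re (a * f x + h x)) = (fun x =>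
      complex.Re a * complex.Re (f x) +
      (- complex.Im a * complex.Im (f x) + complex.Re (h x))).
    by apply/funext => x; case: a {bDRe bDIm} (f x) (h x) => a b [c d] [e k] /=; ring.
  have -> : (fun x => complex.Im (a * f x + h x)) = (fun x =>
      complex.Re a * complex.Im (f x) +
      (complex.Im a * complex.Re (f x) + complex.Im (h x))).
    by apply/funext => x; case: a {bDRe bDIm} (f x) (h x) => a b [c d] [e k] /=; ring.
  rewrite !Mlin//; try by [exact: bRe|exact: bIm].
  case: a {bDRe bDIm} => a b /=; apply/eqP; rewrite eq_complex /=.
  by apply/andP; split; apply/eqP; ring.
- move=> f bf f0; rewrite lecE /=; apply/andP; split; last first.
    by apply: Mge0 => [|x]; [exact: bRe|have := f0 x; rewrite lecE => /andP[]].
  rewrite -M0; apply/eqP; congr M; apply/funext => x.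
  by have := f0 x; rewrite lecE => /andP[/eqP].
- by rewrite M1 M0.
- move=> f bf.
  have -> : (fun x => complex.Im (f x)^*) = (fun x => -1 * complex.Im (f x)).
    by apply/funext => x; rewrite mulN1r; case: (f x).
  rewrite MZ; last exact: bIm.
  rewrite mulN1r; congr (M _ +i* _)%C.
  by apply/funext => x; case: (f x).
- move=> f g bf; congr (_ +i* _)%C.
    exact: (Mtr (fun x => complex.Re (f x)) g (bRe f bf)).
  exact: (Mtr (fun x => complex.Im (f x)) g (bIm f bf)).
- move=> f; congr (_ +i* _)%C.
    exact: (MV (fun x => complex.Re (f x))).
  exact: (MV (fun x => complex.Im (f x))).
Qed.

(** * Elementary properties of an invariant mean *)

Section MeanTheory.
Context (C : numClosedFieldType) (G : groupType) (M : (G -> C) -> C).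
Context (HM : invariant_mean M).
Implicit Types f h : G -> C.

Lemma mean_cst c : M (fun=> c) = c.
Proof.
have b1 := @bdd_cst C G 1; have b0 := @bdd_cst C G 0.
have M0 : M (fun=> 0) = 0.
  have := mean_linear HM (-1) b1 b1.
  by rewrite (mean1 HM) mulN1r addNr.
have := mean_linear HM c b1 b0.
by rewrite (mean1 HM) M0 mulr1 !addr0.
Qed.

Lemma meanD f h : bdd f -> bdd h -> M (fun x => f x + h x) = M f + M h.
Proof.
move=> bf bh; rewrite -[M f]mul1r -(mean_linear HM)//.
by congr M; apply/funext => x; rewrite mul1r.
Qed.

Lemma meanZ a f : bdd f -> M (fun x => a * f x) = a * M f.
Proof.
move=> bf; rewrite -[RHS]addr0 -[in RHS](mean_cst 0) -(mean_linear HM)//.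
  by congr M; apply/funext => x; rewrite addr0.
exact: bdd_cst.
Qed.

Lemma meanB f h : bdd f -> bdd h -> M (fun x => f x - h x) = M f - M h.
Proof.
move=> bf bh; rewrite meanD//; last exact: bddN.
congr (_ + _); rewrite -mulN1r -meanZ//.
by congr M; apply/funext => x; rewrite mulN1r.
Qed.

Lemma mean_sum (I : Type) (s : seq I) (F : I -> G -> C) :
  (forall i, bdd (F i)) -> M (fun x => \sum_(i <- s) F i x) = \sum_(i <- s) M (F i).
Proof.
move=> bF; suff [] : bdd (fun x => \sum_(i <- s) F i x) /\
  M (fun x => \sum_(i <- s) F i x) = \sum_(i <- s) M (F i) by [].
elim: s => [|i s [IHb IH]].
  under eq_fun do rewrite big_nil.
  by rewrite big_nil mean_cst; split=> //; exact: bdd_cst.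
under eq_fun do rewrite big_cons.
by rewrite meanD// IH big_cons; split=> //; exact: bddD.
Qed.

(** Expand the mean of |f - t h| ^+ 2 >= 0 at the minimising t. *)
Lemma mean_cauchy_schwarz f h : bdd f -> bdd h ->
  M (fun x => h x * (h x)^*) != 0 ->
  `|M (fun x => f x * (h x)^*)| ^+ 2 <=
    M (fun x => f x * (f x)^*) * M (fun x => h x * (h x)^*).
Proof.
move=> bf bh N0; have bfc := bdd_conj bf; have bhc := bdd_conj bh.
set N := M (fun x => h x * (h x)^*) in N0 *.
set F := M (fun x => f x * (f x)^*).
set c := M (fun x => f x * (h x)^*).
have Npos : 0 < N.
  rewrite lt_def N0/=; apply: (mean_ge0 HM); first exact: bddM.
  by move=> x; rewrite mul_conjC_ge0.
have cE : M (fun x => h x * (f x)^*) = c^*.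
  rewrite -(mean_conj HM); last exact: bddM.
  by congr M; apply/funext => x; rewrite rmorphM/= conjCK mulrC.
have NE : N^* = N by apply: geC0_conj; exact: ltW.
pose t := c / N.
have tE : t^* = c^* / N by rewrite /t fmorph_div/= NE.
have : 0 <= M (fun x => (f x - t * h x) * (f x - t * h x)^*).
  apply: (mean_ge0 HM).
    by apply: bddM; [|apply: bdd_conj]; apply: bddD => //; apply: bddN;
      apply: bddM => //; exact: bdd_cst.
  by move=> x; rewrite mul_conjC_ge0.
have -> : (fun x => (f x - t * h x) * (f x - t * h x)^*) = (fun x =>
    (f x * (f x)^* - t^* * (f x * (h x)^*)) -
    (t * (h x * (f x)^*) - (t * t^*) * (h x * (h x)^*))).
  by apply/funext => x; rewrite rmorphB rmorphM/=; ring.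
have bZ a k : bdd k -> bdd (fun x : G => a * k x : C).
  by move=> bk; apply: bddM => //; exact: bdd_cst.
have b1 := bddM bf bfc; have b2 := bddM bf bhc.
have b3 := bddM bh bfc; have b4 := bddM bh bhc.
have bB (k l : G -> C) : bdd k -> bdd l -> bdd (fun x => k x - l x).
  by move=> bk bl; apply: bddD => //; exact: bddN.
have b5 := bB _ _ b1 (bZ t^* _ b2); have b6 := bB _ _ (bZ t _ b3) (bZ (t * t^*) _ b4).
rewrite (meanB b5 b6) (meanB b1 (bZ _ _ b2)) (meanB (bZ _ _ b3) (bZ _ _ b4)).
rewrite (meanZ _ b2) (meanZ _ b3) (meanZ _ b4).
rewrite -/F -/c -/N cE tE /t normCK.
have -> : F - c^* / N * c - (c / N * c^* - c / N * (c^* / N) * N) =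
          F - (c * c^*) / N by field.
by rewrite subr_ge0 ler_pdivrMr.
Qed.

(** A mean of complex functions is only known to be positive; its contractivity
    is the Cauchy-Schwarz inequality against the constant 1. *)
Lemma mean_norm_le f B : (forall x, `|f x| <= B) -> `|M f| <= B.
Proof.
move=> fB; have bf : bdd f by exists B.
have B0 : 0 <= B by apply: le_trans (fB 1%g).
rewrite -(@ler_pXn2r _ 2)// ?nnegrE//.
have := @mean_cauchy_schwarz f (fun=> 1) bf (@bdd_cst C G 1).
under eq_fun do rewrite conjC1 mulr1.
under [X in _ -> `|M X| ^+ 2 <= _]eq_fun do rewrite conjC1 mulr1.
rewrite (mean1 HM) => /(_ (oner_neq0 _)) /le_trans; apply; rewrite mulr1.
rewrite -subr_ge0 -[B ^+ 2]mean_cst -meanB; [|exact: bdd_cst|].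
  apply: (mean_ge0 HM) => [|x].
    apply: bddD; first exact: bdd_cst.
    by apply/bddN/bddM => //; exact: bdd_conj.
  by rewrite -normCK subr_ge0 ler_pXn2r// nnegrE.
by apply: bddM => //; exact: bdd_conj.
Qed.

Lemma mean_norm_sub_le f h B : bdd f -> bdd h ->
  (forall x, `|f x - h x| <= B) -> `|M f - M h| <= B.
Proof. by move=> bf bh fhB; rewrite -meanB//; exact: mean_norm_le. Qed.

Lemma mean_step (s : seq G) (r : G -> G) (phi : G -> C) : uniq s ->
  (forall x, r x \in s) ->
  M (fun x => phi (r x)) = \sum_(z <- s) phi z * M (fun x => (r x == z)%:R).
Proof.
move=> us rs.
have b1 z : bdd (fun x => (r x == z)%:R : C).
  by exists 1 => x; rewrite normr_nat lern1 leq_b1.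
have -> : (fun x => phi (r x)) = (fun x => \sum_(z <- s) phi z * (r x == z)%:R).
  apply/funext => x; rewrite (bigD1_seq (r x))//= eqxx mulr1 big1 ?addr0//.
  by move=> z; rewrite eq_sym => /negbTE ->; rewrite mulr0.
rewrite mean_sum.
  by apply: eq_bigr => z _; rewrite meanZ.
by move=> z; apply: bddM => //; exact: bdd_cst.
Qed.
End MeanTheory.

(** * The mean of continuous functions on a compact group *)

Section CompactFunctions.
Context (C : numClosedFieldType).

(** Near-covering compactness, applied to the filter of the finite sets that
    contain a given finite set. *)
Lemma compact_finite_cover (T : topologicalType) (Q : T -> set T) :
  compact [set: T] -> (forall x, \forall y \near x, Q x y) ->
  exists2 s : seq T, uniq s & forall y, exists2 x, x \in s & Q x y.
Proof.
move=> /compact_near_coveringP cT nQ.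
pose F : set_system (seq T) :=
  [set P | exists s0 : seq T, forall s : seq T, {subset s0 <= s} -> P s].
have FF : ProperFilter F.
  split; first by move=> [s0 /(_ s0)]; exact.
  split; first by exists [::].
  - move=> P P' [s sP] [s' sP']; exists (s ++ s') => t st; split.
      by apply: sP => x xs; apply: st; rewrite mem_cat xs.
    by apply: sP' => x xs; apply: st; rewrite mem_cat xs orbT.
  - by move=> P P' PP' [s sP]; exists s => t /sP /PP'.
have /(_ _)[|s sP] := cT _ F (fun s y => exists2 x, x \in s & Q x y) _.
  move=> x _; exists ([set y | Q x y], [set s : seq T | x \in s]) => /=.
    by split; [exact: nQ|exists [:: x] => s; apply; rewrite inE].
  by move=> [y s] /= [Qxy xs]; exists x.
exists (undup s); first exact: undup_uniq.
by move=> y; have [x xs Qxy] := sP s (fun _ => id) y I; exists x; rewrite ?mem_undup.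
Qed.

Lemma compact_continuous_bdd (T : topologicalType) (f : T -> C^o) :
  compact [set: T] -> continuous f -> bdd f.
Proof.
move=> cT cf.
have [|s us sP] := @compact_finite_cover T (fun x y => `|f y| <= `|f x| + 1) cT.
  move=> x; have := cf x => /cvgrPdist_le /(_ 1 ltr01).
  apply: filterS => y fxy; rewrite -lerBlDl.
  by rewrite (le_trans (lerB_dist _ _))// distrC.
exists (\sum_(x <- s) (`|f x| + 1)) => y.
have [x xs /le_trans] := sP y; apply.
by rewrite (bigD1_seq x)//= lerDl sumr_ge0.
Qed.

(** The tube lemma: continuity in x is uniform along the compact factor. *)
Lemma tube_continuous (S T : topologicalType) (F : S * T -> C^o) :
  compact [set: T] -> continuous F ->
  forall x e, 0 < e -> \forall x' \near x, forall y, `|F (x, y) - F (x', y)| <= e.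
Proof.
move=> /compact_near_coveringP cT cF x e e0.
suff : \forall x' \near x, [set: T] `<=` (fun y => `|F (x, y) - F (x', y)| <= e).
  by apply: filterS => x' H y; exact: (H y I).
apply: (cT _ (nbhs x) (fun x' y => `|F (x, y) - F (x', y)| <= e)).
move=> y _; have e20 : 0 < e / 2 by rewrite divr_gt0.
have /cvgrPdist_le /(_ _ e20) [[A B] /= [xA yB] AB] := cF (x, y).
exists (B, A) => //= -[y' x'] /= [By' Ax'].
have H1 : `|F (x, y) - F (x, y')| <= e / 2.
  by apply: (AB (x, y')); split => //=; exact: nbhs_singleton.
have H2 : `|F (x, y) - F (x', y')| <= e / 2 by exact: (AB (x', y')).
rewrite [e]splitr -(subrKA (F (x, y))) (le_trans (ler_normD _ _))//.
by rewrite lerD// distrC.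
Qed.
End CompactFunctions.

Section MeanContinuous.
Context (C : numClosedFieldType) (G : topologicalGroupType).
Context (cG : compact [set: G]).
Context (M : (G -> C) -> C) (HM : invariant_mean M).

Let bddF (F : G * G -> C^o) : continuous F -> bdd F.
Proof.
move=> cF; apply: compact_continuous_bdd => //.
by rewrite -setXTT; exact: compact_setX.
Qed.

Let bddM2 (F : G * G -> C^o) : bdd F -> bdd (fun x => M (fun y => F (x, y))).
Proof. by move=> [B FB]; exists B => x; exact: (mean_norm_le HM). Qed.

Lemma mean_param_continuous (F : G * G -> C^o) : continuous F ->
  continuous ((fun x => M (fun y => F (x, y))) : G -> C^o).
Proof.
move=> cF x; apply/cvgrPdist_le => e e0.
have := tube_continuous cG cF x e0; apply: filterS => x' H.
have bF := bddF cF.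
by apply: (mean_norm_sub_le HM); [exact: bdd_comp bF|exact: bdd_comp bF|].
Qed.

(** No uniqueness of the mean is involved: by compactness F is, up to e / 2,
    the function F (r x, y) for a map r with finitely many values, and for such a
    function both iterated means are the same finite sum, weighted by the means m
    of the indicator functions of the fibres of r. *)
Lemma mean_fubini (F : G * G -> C^o) : continuous F ->
  M (fun x => M (fun y => F (x, y))) = M (fun y => M (fun x => F (x, y))).
Proof.
move=> cF; have bF := bddF cF.
apply/eqP; rewrite -subr_eq0 -normr_le0; apply/ler_addgt0Pr => e e0; rewrite add0r.
have e20 : 0 < e / 2 by rewrite divr_gt0.
have [s us sP] := compact_finite_cover cG (fun x => tube_continuous cG cF x e20).
have /choice[r rP] : forall y, exists x,
    x \in s /\ forall z, `|F (x, z) - F (y, z)| <= e / 2.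
  by move=> y; have [x xs H] := sP y; exists x.
pose m z := M (fun x => (r x == z)%:R).
have rs x : r x \in s by have [] := rP x.
have rF x y : `|F (x, y) - F (r x, y)| <= e / 2 by rewrite distrC; have [] := rP x.
pose b := \sum_(z <- s) M (fun y => F (z, y)) * m z.
have H1 : `|M (fun x => M (fun y => F (x, y))) - b| <= e / 2.
  rewrite /b -(@mean_step _ _ _ HM _ _ (fun z => M (fun y => F (z, y))) us rs).
  apply: (mean_norm_sub_le HM); [exact: bddM2|exact: (bdd_comp r (bddM2 bF))|move=> x].
  by apply: (mean_norm_sub_le HM); [exact: bdd_comp bF|exact: bdd_comp bF|].
have H2 : `|M (fun y => M (fun x => F (x, y))) - b| <= e / 2.
  have -> : b = M (fun y => M (fun x => F (r x, y))).
    have -> : (fun y => M (fun x => F (r x, y))) =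
              (fun y => \sum_(z <- s) F (z, y) * m z).
      by apply/funext => y; exact: (@mean_step _ _ _ HM _ _ (fun z => F (z, y)) us rs).
    rewrite (mean_sum HM) => [|z].
      apply: eq_bigr => z _; rewrite mulrC -(meanZ HM); last exact: bdd_comp bF.
      by congr M; apply/funext => y; rewrite mulrC.
    by apply: bddM; [exact: bdd_comp bF|exact: bdd_cst].
  apply: (mean_norm_sub_le HM).
  - exact: (@bddM2 (fun p => F (p.2, p.1)) (bdd_comp _ bF)).
  - exact: (@bddM2 (fun p => F (r p.2, p.1)) (bdd_comp _ bF)).
  move=> y; apply: (mean_norm_sub_le HM); [exact: bdd_comp bF| |by []].
  exact: (bdd_comp (fun x => (r x, y)) bF).
rewrite [e]splitr -(subrKA b) (le_trans (ler_normD _ _))//.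
by rewrite lerD// distrC.
Qed.

(** If f x0 > 0, finitely many translates of f add up to at least f x0 / 2
    everywhere, although they all have the mean of f. *)
Lemma mean_faithful (f : G -> C^o) : continuous f -> (forall x, 0 <= f x) ->
  M f = 0 -> forall x, f x = 0.
Proof.
move=> cf f0 Mf0 x0; apply/eqP/negPn/negP => fx0.
have fx0' : 0 < f x0 by rewrite lt_def fx0 f0.
have bf := compact_continuous_bdd cG cf.
pose e := f x0 / 2; have e0 : 0 < e by rewrite divr_gt0.
have cfm z : continuous (fun y => f (x0 * (z^-1 * y))%g).
  move=> y; apply: (@continuous_comp _ _ _ (fun y => (x0 * (z^-1 * y))%g) f);
    last exact: cf.
  apply: (@continuous_comp _ _ _ (fun y => (x0, z^-1 * y)%g) (fun p => (p.1 * p.2)%g));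
    last exact: mulg_continuous.
  apply: cvg_pair; first exact: cvg_cst.
  apply: (@continuous_comp _ _ _ (fun y => (z^-1, y)%g) (fun p => (p.1 * p.2)%g));
    last exact: mulg_continuous.
  by apply: cvg_pair; [exact: cvg_cst|exact: cvg_id].
have [|s us sP] := @compact_finite_cover G (fun z y => e <= f (x0 * (z^-1 * y))%g) cG.
  move=> z; have := cfm z z => /cvgrPdist_le /(_ _ e0); apply: filterS => y.
  rewrite mulVg mulg1 => H.
  have := le_trans (lerB_dist _ _) H; rewrite !ger0_norm// => {}H.
  by rewrite -(lerD2r e) -splitr -lerBlDl.
pose F z y := f (x0 * (z^-1 * y))%g.
have bF z : bdd (F z) by exact: bdd_comp bf.
have bS : bdd (fun y => \sum_(z <- s) F z y).
  elim: s {us sP} => [|z s IH].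
    by under eq_fun do rewrite big_nil; exact: bdd_cst.
  by under eq_fun do rewrite big_cons; exact: bddD.
have : e <= M (fun y => \sum_(z <- s) F z y).
  rewrite -subr_ge0 -[e](mean_cst HM) -(meanB HM).
  - apply: (mean_ge0 HM) => [|y].
      by apply: bddD => //; apply: bddN; exact: bdd_cst.
    rewrite subr_ge0; have [x xs /le_trans] := sP y; apply.
    by rewrite (bigD1_seq x)//= lerDl sumr_ge0// => z _; exact: f0.
  - exact: bS.
  - exact: bdd_cst.
rewrite (mean_sum HM)//.
rewrite big1 => [|z _]; first by rewrite lt_geF.
rewrite -Mf0 -(mean_translate HM (x0 * z^-1)%g bf).
by congr M; apply/funext => y; rewrite /F mulgA.
Qed.
End MeanContinuous.

(** * Monotone and Cauchy sequences *)

(** Only the completeness properties of the complex numbers that the spectral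
    argument relies on are isolated here, so that it can be carried out over an
    arbitrary closed field with a norm. *)
Definition order_complete (C : numDomainType) := forall u : nat -> C,
  (forall n, u n <= u n.+1) -> (exists B, forall n, u n <= B) ->
  exists l, (forall n, u n <= l) /\ forall B, (forall n, u n <= B) -> l <= B.

Definition seq_cvg (C : numDomainType) (u : nat -> C) (l : C) :=
  forall e, 0 < e -> exists N, forall n, (N <= n)%N -> `|u n - l| <= e.

Definition seq_cauchy (C : numDomainType) (u : nat -> C) :=
  forall e, 0 < e -> exists N, forall n m, (N <= n)%N -> (N <= m)%N ->
    `|u n - u m| <= e.

Definition cauchy_complete (C : numDomainType) :=
  forall u : nat -> C, seq_cauchy u -> exists l, seq_cvg u l.

Section OrderComplete.
Context (C : numClosedFieldType) (C_lub : order_complete C).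

Lemma nonincreasing_cauchy (b : nat -> C) :
  (forall n, 0 <= b n) -> (forall n, b n.+1 <= b n) -> seq_cauchy b.
Proof.
move=> b0 bS.
have [||l [bl lb]] := C_lub (u := fun n => b 0%N - b n).
- by move=> n; rewrite lerD2l lerN2.
- by exists (b 0%N) => n; rewrite gerBl.
have br n : b n \is Num.real by exact: ger0_real.
have lr : l \is Num.real.
  by rewrite -(ler_real (bl 0%N)) realB.
move=> e e0; have er := gtr0_real e0.
have [N bN] : exists N, l - e <= b 0%N - b N.
  apply: contrapT => /forallNP H.
  have : l <= l - e.
    apply: lb => n; have /negP := H n.
    by rewrite -real_ltNge ?realB// => /ltW.
  by rewrite lerDl oppr_ge0 lt_geF.
have bmono n m : (n <= m)%N -> b m <= b n.
  move=> /subnK <-; elim: (m - n)%N => // i IH; exact: le_trans (bS _) IH.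
have H n : (N <= n)%N -> l - e <= b 0%N - b n <= l.
  by move=> Nn; rewrite bl andbT (le_trans bN)// lerD2l lerN2 bmono.
exists N => n m /H /andP[n1 n2] /H /andP[m1 m2].
rewrite real_ler_norml ?realB//.
have -> : b n - b m = (b 0%N - b m) - (b 0%N - b n) by ring.
apply/andP; split.
  by rewrite lerBrDr (le_trans _ m1)// addrC lerB.
by rewrite lerBlDr (le_trans m2)// -lerBlDl.
Qed.

Lemma nat_bound (x : C) : 0 <= x -> exists n, x <= n%:R.
Proof.
move=> x0; apply: contrapT => /forallNP H.
have [||l [nl ln]] := C_lub (u := fun n => n%:R).
- by move=> n; rewrite ler_nat.
- exists x => n; have /negP := H n.
  by rewrite -real_ltNge ?ger0_real// => /ltW.
have : l <= l - 1 by apply: ln => n; rewrite lerBrDr natr1.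
by rewrite lerDl oppr_ge0 lt_geF.
Qed.
End OrderComplete.

(** * The convolution algebra *)

Section ContinuousFunctions.
Context (C : numClosedFieldType) (G : topologicalType).

Definition cts : {pred G -> C^o} := mem [set f : G -> C^o | continuous f].

Lemma cts_submod_closed : submod_closed cts.
Proof.
split=> [|a f g]; rewrite !inE /=; first by move=> x; exact: cvg_cst.
move=> cf cg x; apply: cvgD; last exact: cg.
by apply: cvgZr; exact: cf.
Qed.

HB.instance Definition _ := GRing.isSubmodClosed.Build C (G -> C^o) cts
  cts_submod_closed.

Record cfun := CFun { cfun_val :> G -> C^o; _ : cfun_val \in cts }.
HB.instance Definition _ := [isSub for cfun_val].
HB.instance Definition _ := [Choice of cfun by <:].
HB.instance Definition _ := [SubChoice_isSubLmodule of cfun by <:].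

Definition mkcfun (f : G -> C^o) (cf : continuous f) : cfun :=
  CFun (mem_set cf : f \in cts).

Lemma cfun_cts (f : cfun) : continuous f.
Proof. by case: f => f /= /set_mem. Qed.

Lemma cfunP (f g : cfun) : (forall x, f x = g x) -> f = g.
Proof. by move=> fg; apply/val_inj/funext. Qed.

Lemma cfunDE (f g : cfun) x : (f + g) x = f x + g x. Proof. by []. Qed.
Lemma cfunNE (f : cfun) x : (- f) x = - f x. Proof. by []. Qed.
Lemma cfunBE (f g : cfun) x : (f - g) x = f x - g x. Proof. by []. Qed.
Lemma cfunZE a (f : cfun) x : (a *: f) x = a * f x. Proof. by []. Qed.
Lemma cfun0E x : (0 : cfun) x = 0. Proof. by []. Qed.

End ContinuousFunctions.

Section ConvolutionAlgebra.
Context (C : numClosedFieldType) (G : topologicalGroupType).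
Context (cG : compact [set: G]) (GC : commutative (@monoid.mul G)).
Context (M : (G -> C) -> C) (HM : invariant_mean M).
Local Notation A := (cfun C G).
Implicit Types (f g h k p q : A) (a : C).

Let bddC f : bdd f.
Proof. by apply: compact_continuous_bdd => //; exact: cfun_cts. Qed.

Fact mulg_comp_continuous (S : topologicalType) (u v : S -> G) :
  continuous u -> continuous v -> continuous (fun x : S => (u x * v x)%g).
Proof.
move=> cu cv x.
apply: (@continuous_comp _ _ _ (fun y => (u y, v y)) (fun p : G * G => (p.1 * p.2)%g));
  last exact: mulg_continuous.
by apply: cvg_pair; [exact: cu|exact: cv].
Qed.

Fact invg_comp_continuous (S : topologicalType) (u : S -> G) :
  continuous u -> continuous (fun x : S => (u x)^-1%g).
Proof.
move=> cu x.
apply: (@continuous_comp _ _ _ u (fun z : G => z^-1%g)); first exact: cu.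
exact: invg_continuous.
Qed.

Fact cfun_comp_continuous (S : topologicalType) (u : S -> G) f :
  continuous u -> continuous (fun x : S => f (u x)).
Proof. by move=> cu x; apply: continuous_comp; [exact: cu|exact: cfun_cts]. Qed.

Fact mul_comp_continuous (S : topologicalType) (u v : S -> C^o) :
  continuous u -> continuous v -> continuous ((fun x : S => u x * v x) : S -> C^o).
Proof. by move=> cu cv x; apply: cvgM; [exact: cu|exact: cv]. Qed.

Fact fst_continuous (S T : topologicalType) : continuous (@fst S T).
Proof. by move=> x; exact: cvg_fst. Qed.

Fact snd_continuous (S T : topologicalType) : continuous (@snd S T).
Proof. by move=> x; exact: cvg_snd. Qed.

Let cid (S : topologicalType) : continuous (fun x : S => x).
Proof. by move=> x; exact: cvg_id. Qed.

Let ccst (S T : topologicalType) (y : T) : continuous (fun x : S => y).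
Proof. by move=> x; exact: cvg_cst. Qed.

Fact conv_continuous f g :
  continuous ((fun y => M (fun x => f x * g (x^-1 * y)%g)) : G -> C^o).
Proof.
apply: (mean_param_continuous cG HM (F := fun p : G * G => f p.2 * g (p.2^-1 * p.1)%g)).
apply: mul_comp_continuous; apply: cfun_comp_continuous.
  exact: snd_continuous.
by apply: mulg_comp_continuous; [apply: invg_comp_continuous;
  exact: snd_continuous|exact: fst_continuous].
Qed.

Definition conv f g : A := mkcfun (@conv_continuous f g).
Local Infix "**" := conv (at level 40, left associativity).

Fact star_continuous f : continuous ((fun x => (f x^-1%g)^*) : G -> C^o).
Proof.
move=> x; apply/cvgrPdist_le => e e0.
have /cvgrPdist_le /(_ e e0) :=
  @cfun_comp_continuous _ _ f (invg_comp_continuous (@cid G)) x.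
by apply: filterS => y; rewrite -rmorphB norm_conjC.
Qed.

Definition star f : A := mkcfun (@star_continuous f).

Fact translate_continuous y f : continuous ((fun x => f (y * x)%g) : G -> C^o).
Proof.
by apply: cfun_comp_continuous; apply: mulg_comp_continuous; [exact: ccst|exact: cid].
Qed.

Definition translate y f : A := mkcfun (@translate_continuous y f).

Lemma convE f g y : (f ** g) y = M (fun x => f x * g (x^-1 * y)%g).
Proof. by []. Qed.

Lemma starE f x : star f x = (f x^-1%g)^*. Proof. by []. Qed.

Lemma translateE y f x : translate y f x = f (y * x)%g. Proof. by []. Qed.

Let bddconv f g y : bdd (fun x => f x * g (x^-1 * y)%g).
Proof. by apply: bddM => //; exact: (bdd_comp (fun x => (x^-1 * y)%g) (bddC g)). Qed.

Lemma convC : commutative conv.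
Proof.
move=> f g; apply: cfunP => y; rewrite !convE.
rewrite -(mean_translate HM y (bddconv f g y)).
rewrite -(mean_inv HM); congr M; apply/funext => x.
by rewrite mulrC invgM invgK -mulgA mulVg mulg1 (GC y).
Qed.

Lemma convDl f g h : (f + g) ** h = f ** h + g ** h.
Proof.
apply: cfunP => y; rewrite cfunDE !convE -(meanD HM) //.
by congr M; apply/funext => x; rewrite cfunDE mulrDl.
Qed.

Lemma convZl a f g : (a *: f) ** g = a *: (f ** g).
Proof.
apply: cfunP => y; rewrite cfunZE !convE -(meanZ HM) //.
by congr M; apply/funext => x; rewrite cfunZE mulrA.
Qed.

Lemma convDr f g h : f ** (g + h) = f ** g + f ** h.
Proof. by rewrite !(convC f) convDl. Qed.

Lemma convZr a f g : f ** (a *: g) = a *: (f ** g).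
Proof. by rewrite !(convC f) convZl. Qed.

Lemma convNl f g : (- f) ** g = - (f ** g).
Proof. by rewrite -scaleN1r convZl scaleN1r. Qed.

Lemma convNr f g : f ** (- g) = - (f ** g).
Proof. by rewrite !(convC f) convNl. Qed.

Lemma conv0 f : f ** 0 = 0.
Proof. by have := convZr 0 f 0; rewrite !scale0r. Qed.

(** Fubini, followed by a translation of the inner variable. *)
Lemma convA : associative conv.
Proof.
move=> f g h; apply: cfunP => z; rewrite !convE.
pose F (p : G * G) := f p.1 * (g (p.1^-1 * p.2)%g * h (p.2^-1 * z)%g).
have cF : continuous (F : _ -> C^o).
  apply: mul_comp_continuous.
    by apply: cfun_comp_continuous; exact: fst_continuous.
  apply: mul_comp_continuous; apply: cfun_comp_continuous.
    by apply: mulg_comp_continuous; [apply: invg_comp_continuous;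
      exact: fst_continuous|exact: snd_continuous].
  apply: mulg_comp_continuous; last exact: ccst.
  by apply: invg_comp_continuous; exact: snd_continuous.
transitivity (M (fun x => M (fun y => F (x, y)))).
  congr M; apply/funext => x; rewrite convE.
  rewrite -(meanZ HM) //.
  rewrite -(mean_translate HM x^-1%g); last first.
    by apply: bddM; [exact: bdd_cst|exact: bddconv].
  congr M; apply/funext => y.
  by rewrite /F/= invgM invgK -mulgA (mulgA x) mulgV mul1g.
rewrite (mean_fubini cG HM cF); congr M; apply/funext => y.
rewrite convE mulrC -(meanZ HM) //.
by congr M; apply/funext => x; rewrite /F/=; ring.
Qed.

Lemma starK f : star (star f) = f.
Proof. by apply: cfunP => x; rewrite !starE conjCK invgK. Qed.

Lemma starD f g : star (f + g) = star f + star g.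
Proof. by apply: cfunP => x; rewrite cfunDE !starE cfunDE rmorphD. Qed.

Lemma starZ a f : star (a *: f) = a^* *: star f.
Proof. by apply: cfunP => x; rewrite cfunZE !starE cfunZE rmorphM. Qed.

Lemma starN f : star (- f) = - star f.
Proof. by apply: cfunP => x; rewrite cfunNE !starE cfunNE rmorphN. Qed.

Lemma star_conv f g : star (f ** g) = star f ** star g.
Proof.
apply: cfunP => y; rewrite starE !convE -(mean_conj HM)//.
rewrite -(mean_inv HM); congr M; apply/funext => x.
by rewrite !starE rmorphM/= !invgM !invgK (GC _ x).
Qed.

(** The convolution algebra sees the group through this identity: translations
    are module endomorphisms, so they preserve every ideal. *)
Lemma translate_conv y f g : translate y (f ** g) = f ** translate y g.
Proof.
apply: cfunP => x; rewrite translateE !convE; congr M; apply/funext => z.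
by rewrite translateE !mulgA (GC y).
Qed.

Lemma star_translate y f : star (translate y f) = translate y^-1%g (star f).
Proof.
apply: cfunP => x; rewrite starE !translateE starE invgM invgK.
by rewrite GC.
Qed.

(** Evaluation at 1 is a trace on the convolution algebra, and this is the square
    of the norm that it induces, which is the L2 norm by [nrm2E]. *)
Definition nrm2 f : C := (f ** star f) 1%g.

Lemma nrm2E f : nrm2 f = M (fun x => f x * (f x)^*).
Proof.
by rewrite /nrm2 convE; congr M; apply/funext => x; rewrite starE mulg1 invgK.
Qed.

Lemma nrm2_ge0 f : 0 <= nrm2 f.
Proof.
rewrite nrm2E; apply: (mean_ge0 HM); first by apply: bddM => //; exact: bdd_conj.
by move=> x; rewrite mul_conjC_ge0.
Qed.

Lemma nrm2_eq0 f : (nrm2 f == 0) = (f == 0).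
Proof.
apply/eqP/eqP => [|->]; last by rewrite /nrm2 convC conv0.
rewrite nrm2E => f0; apply: cfunP => x; rewrite cfun0E.
apply/eqP; rewrite -mul_conjC_eq0; apply/eqP; move: x.
apply: (mean_faithful cG HM _ _ f0) => [|x]; last exact: mul_conjC_ge0.
apply: mul_comp_continuous; first exact: cfun_cts.
move=> x; apply/cvgrPdist_le => e e0.
have /cvgrPdist_le /(_ e e0) := @cfun_cts _ _ f x.
by apply: filterS => y; rewrite -rmorphB norm_conjC.
Qed.

Lemma nrm2_star f : nrm2 (star f) = nrm2 f.
Proof. by rewrite /nrm2 starK convC. Qed.

Lemma nrm2_translate y f : nrm2 (translate y f) = nrm2 f.
Proof.
rewrite !nrm2E; rewrite -[RHS](mean_translate HM y)//.
by apply: bddM => //; exact: bdd_conj.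
Qed.

(** The smoothing property of convolution: it bounds a supremum norm by L2 norms,
    so that convolving an L2-Cauchy sequence makes it uniformly Cauchy. *)
Lemma conv_norm_le f g y : `|(f ** g) y| ^+ 2 <= nrm2 f * nrm2 g.
Proof.
have [->|g0] := eqVneq g 0.
  by rewrite conv0 normr0 expr0n /= mulr_ge0// nrm2_ge0.
pose h := star (translate y g).
have hE x : (h x)^* = g (x^-1 * y)%g.
  by rewrite /h starE translateE conjCK GC.
have -> : nrm2 g = nrm2 h by rewrite /h nrm2_star nrm2_translate.
have : nrm2 h != 0 by rewrite /h nrm2_star nrm2_translate nrm2_eq0.
rewrite !nrm2E convE; move=> /(mean_cauchy_schwarz HM (bddC f) (bddC h)).
by under [X in `|M X| ^+ 2 <= _ -> _]eq_fun do rewrite hE.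
Qed.

Lemma mean_conv1 f g : (f ** star g) 1%g = M (fun x => f x * (g x)^*).
Proof. by rewrite convE; congr M; apply/funext => x; rewrite starE mulg1 invgK. Qed.

(** * Uniform limits in the convolution algebra *)

Definition unif_cvg (u : nat -> A) (q : A) :=
  forall e, 0 < e -> exists N, forall n, (N <= n)%N -> forall y, `|u n y - q y| <= e.

Definition unif_cauchy (u : nat -> A) :=
  forall e, 0 < e -> exists N, forall n m, (N <= n)%N -> (N <= m)%N ->
    forall y, `|u n y - u m y| <= e.

Context (C_lub : order_complete C) (C_complete : cauchy_complete C).

Lemma unif_complete (u : nat -> A) : unif_cauchy u -> exists q, unif_cvg u q.
Proof.
move=> uc.
have /choice[q qP] : forall y, exists l, seq_cvg (fun n => u n y) l.
  move=> y; apply: C_complete => e /uc[N H]; exists N => n m nN mN; exact: H.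
have uq e : 0 < e -> exists N, forall n, (N <= n)%N -> forall y, `|u n y - q y| <= e.
  move=> e0; have e20 : 0 < e / 2 by rewrite divr_gt0.
  have [N H] := uc _ e20; exists N => n Nn y.
  have [N' H'] := qP y _ e20.
  rewrite [e]splitr -(subrKA (u (maxn N N') y)) (le_trans (ler_normD _ _))//.
  by rewrite lerD// ?H ?H'// ?leq_maxl ?leq_maxr.
have cq : continuous (q : G -> C^o).
  move=> x; apply/cvgrPdist_le => e e0.
  have e30 : 0 < e / 3 by rewrite divr_gt0.
  have [N /(_ N (leqnn N)) H] := uq _ e30.
  have /cvgrPdist_le /(_ _ e30) := @cfun_cts _ _ (u N) x.
  apply: filterS => y Hy.
  have -> : q x - q y = (q x - u N x) + (u N x - u N y) + (u N y - q y) by ring.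
  have -> : e = e / 3 + e / 3 + e / 3 by field.
  rewrite (le_trans (ler_normD _ _))// lerD//.
  by rewrite (le_trans (ler_normD _ _))// lerD// distrC.
by exists (mkcfun cq).
Qed.

Lemma unif_cvg_unique u q q' : unif_cvg u q -> unif_cvg u q' -> q = q'.
Proof.
move=> uq uq'; apply: cfunP => y; apply/eqP; rewrite -subr_eq0 -normr_le0.
apply/ler_addgt0Pr => e e0; rewrite add0r.
have e20 : 0 < e / 2 by rewrite divr_gt0.
have [N H] := uq _ e20; have [N' H'] := uq' _ e20.
rewrite [e]splitr -(subrKA (u (maxn N N') y)) (le_trans (ler_normD _ _))//.
by apply: lerD; [rewrite distrC H ?leq_maxl|rewrite H' ?leq_maxr].
Qed.

Lemma unif_cvg_cst q : unif_cvg (fun=> q) q.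
Proof. by move=> e e0; exists 0%N => n _ y; rewrite subrr normr0 ltW. Qed.

Lemma unif_cvgZ a u q : unif_cvg u q -> unif_cvg (fun n => a *: u n) (a *: q).
Proof.
move=> uq e e0; have a0 : 0 < `|a| + 1 by rewrite ltr_wpDl.
have [|N H] := uq (e / (`|a| + 1)); first by rewrite divr_gt0.
exists N => n /H Hn y; rewrite !cfunZE -mulrBr normrM.
have := Hn y; rewrite ler_pdivlMr// => /(le_trans _); apply.
by rewrite mulrC ler_wpM2l// lerDl.
Qed.

Lemma unif_cvg_star u q : unif_cvg u q -> unif_cvg (fun n => star (u n)) (star q).
Proof.
move=> uq e /uq[N H]; exists N => n /H Hn y.
by rewrite !starE -rmorphB norm_conjC.
Qed.

Lemma unif_cvg_conv f u q : unif_cvg u q -> unif_cvg (fun n => f ** u n) (f ** q).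
Proof.
move=> uq e e0; have [B fB] := bddC f.
have B0 : 0 <= B by apply: le_trans (fB 1%g).
have B10 : 0 < B + 1 by rewrite ltr_wpDl.
have [|N H] := uq (e / (B + 1)); first by rewrite divr_gt0.
exists N => n /H Hn y; rewrite !convE; apply: (mean_norm_sub_le HM) => // x.
rewrite -mulrBr normrM (le_trans (ler_pM _ _ (fB x) (Hn _)))//.
rewrite mulrA ler_pdivrMr// mulrC ler_wpM2l ?lerDl//; exact: ltW.
Qed.

(** * The largest eigenvalue of a self-adjoint element *)

Section PowerMethod.
Context (k : A) (k_star : star k = k) (k_neq0 : k != 0).

(* pw n is the (n + 1)-st power of k, since the algebra has no unit *)
Let pw n : A := iter n (conv k) k.

Let pwD m n : pw m ** pw n = pw (m + n).+1.
Proof. by elim: m => //= m IH; rewrite -convA IH. Qed.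

Let pw_star n : star (pw n) = pw n.
Proof. by elim: n => //= n IH; rewrite star_conv IH k_star. Qed.

Let pw_neq0 n : pw n != 0.
Proof.
elim: n => //= n IH; apply/negP => /eqP H.
have pw0 i : pw (i + n.+1) = 0.
  by elim: i => [//|i IHi]; rewrite addSn /= IHi conv0.
have := pw0 n; rewrite addnS.
rewrite -pwD => H0; move: IH; rewrite -nrm2_eq0 /nrm2 pw_star H0.
by rewrite cfun0E eqxx.
Qed.

Let h n : A := pw n ** pw n.
Let s n : C := nrm2 (pw n).

Let hE n : h n 1%g = s n. Proof. by rewrite /s /nrm2 pw_star. Qed.

Let h_star n : star (h n) = h n.
Proof. by rewrite /h star_conv pw_star. Qed.

Let h_conv m n : h m ** h n = h (m + n).+1.
Proof. by rewrite /h !pwD; congr pw; rewrite !addSn !addnS addnACA. Qed.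

Let s_gt0 n : 0 < s n.
Proof. by rewrite lt_def nrm2_eq0 pw_neq0 nrm2_ge0. Qed.

(* s n is the trace of k ^ (2 n + 2): Cauchy-Schwarz makes it log-convex, and
   hence the ratios r n of successive terms nondecreasing; it is also
   submultiplicative, because h n is a positive element, whose values are bounded
   by its value at 1. *)
Let s_logconvex n : s n.+1 ^+ 2 <= s n * s n.+2.
Proof.
rewrite -[s n.+1]ger0_norm ?(ltW (s_gt0 _))// -[in X in X <= _]hE.
have -> : h n.+1 = pw n ** pw n.+2.
  by rewrite /h !pwD addSn -addnS.
exact: conv_norm_le.
Qed.

Let s_submul m n : s (m + n).+1 <= s m * s n.
Proof.
have hs j y : `|h j y| <= s j.
  rewrite -(@ler_pXn2r _ 2)// ?nnegrE// ?(ltW (s_gt0 _))//.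
  by rewrite (le_trans (conv_norm_le _ _ _))// expr2.
rewrite -[X in X <= _]ger0_norm ?(ltW (s_gt0 _))// -hE -h_conv -[h n]h_star.
rewrite mean_conv1; apply: (mean_norm_le HM) => x.
by rewrite normrM norm_conjC ler_pM.
Qed.

Let r n : C := s n.+1 / s n.

Let r_gt0 n : 0 < r n. Proof. exact: divr_gt0. Qed.

Let r_incr n : r n <= r n.+1.
Proof.
rewrite /r ler_pdivrMr// mulrAC ler_pdivlMr// -expr2 mulrC.
exact: s_logconvex.
Qed.

Let r_pow m n : r m ^+ n.+1 <= s n.
Proof.
have rmono i : r m <= r (i + m).
  by elim: i => // i /le_trans; apply; exact: r_incr.
have H i : r m ^+ i * s m <= s (i + m).
  elim: i => [|i IH]; first by rewrite mul1r.
  have -> : s (i.+1 + m) = r (i + m) * s (i + m).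
    by rewrite /r divfK ?gt_eqF.
  rewrite exprS -mulrA; apply: ler_pM => //; first exact: ltW.
  by rewrite ltW// mulr_gt0// exprn_gt0.
rewrite -(ler_pM2r (s_gt0 m)) (le_trans (H _))//.
by rewrite addSn s_submul.
Qed.

(** A self-adjoint compact operator has an eigenvalue. With lam the limit of
    the ratios r n of successive traces, the normalised powers u n of k * k, that
    is, h n = (k * k) ^ (n + 1) divided by lam ^ (n + 1), have nonincreasing traces b n, which are at
    least 1 by submultiplicativity. As u m * u n is again a member of the
    sequence, the L2 distances of the u n are differences of values of b, so the
    sequence is L2-Cauchy, and uniformly Cauchy after one more convolution with k * k.
    Its limit q is the spectral projection of k * k for the eigenvalue lam. *)
Lemma power_method : exists lam q, [/\ 0 < lam, q != 0, star q = q, q ** q = q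
  & k ** k ** q = lam *: q].
Proof.
have [||lam [rlam lamr]] := C_lub (u := r).
- exact: r_incr.
- by exists (s 0%N) => n; have := r_pow n 0; rewrite expr1.
have lam0 : 0 < lam by exact: lt_le_trans (r_gt0 0%N) (rlam 0%N).
have lamn0 n : lam ^+ n != 0 by rewrite expf_neq0// gt_eqF.
have lam_pow n : lam ^+ n.+1 <= s n.
  (* taking roots transfers r m ^ (n + 1) <= s n to the supremum of the r m *)
  pose rho := n.+1.-root (s n).
  have rho0 : 0 <= rho by rewrite rootC_ge0// ltW.
  rewrite -[s n](rootCK (ltn0Sn n)) -/rho ler_pXn2r// ?nnegrE ?(ltW lam0)//.
  apply: lamr => m; rewrite -(@ler_pXn2r _ n.+1)// ?nnegrE ?(ltW (r_gt0 _))//.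
  by rewrite rootCK.
pose b n := s n / lam ^+ n.+1.
have b_ge1 n : 1 <= b n by rewrite ler_pdivlMr ?exprn_gt0// mul1r.
have b_decr n : b n.+1 <= b n.
  rewrite /b ler_pdivrMr ?exprn_gt0// mulrAC ler_pdivlMr ?exprn_gt0//.
  rewrite (exprS _ n.+1) mulrA ler_pM2r ?exprn_gt0//.
  by rewrite mulrC -ler_pdivrMr// rlam.
have b_cauchy : seq_cauchy b.
  by apply: (nonincreasing_cauchy C_lub) => // n; exact: le_trans ler01 (b_ge1 n).
pose u n := (lam ^+ n.+1)^-1 *: h n.
have u_star n : star (u n) = u n.
  rewrite starZ h_star geC0_conj// invr_ge0 exprn_ge0//; exact: ltW.
have u_conv m n : u m ** u n = u (m + n).+1.
  rewrite /u convZl convZr h_conv scalerA -invfM -exprD.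
  by rewrite addSn addnS addnC.
have uE n : u n 1%g = b n by rewrite cfunZE hE mulrC.
have hu n : h 0%N ** u n = lam *: u n.+1.
  rewrite /u convZr h_conv add0n scalerA; congr (_ *: _).
  by rewrite [in RHS]exprS invfM mulrA divff ?mul1r// gt_eqF.
have u_cauchy : unif_cauchy (fun n => u n.+1).
  move=> e e0.
  (* d is such that nrm2 (h 0) * (2 * d) = (lam * e) ^ 2 *)
  pose d := (lam * e) ^+ 2 / (nrm2 (h 0%N) * 2).
  have nh0 : 0 < nrm2 (h 0%N).
    by rewrite lt_def nrm2_ge0 nrm2_eq0 /h pwD pw_neq0.
  have d0 : 0 < d by rewrite divr_gt0// ?exprn_gt0 ?mulr_gt0.
  have [N H] := b_cauchy _ d0; exists N => n m Nn Nm y.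
  have nrm : nrm2 (u n - u m) <= 2 * d.
    have -> : nrm2 (u n - u m) =
        (b (n + n).+1 - b (n + m).+1) + (b (m + m).+1 - b (n + m).+1).
      rewrite /nrm2 starD starN !u_star convDl !convDr !convNl !convNr !u_conv.
      by rewrite !(cfunDE, cfunNE) !uE (addnC m n); ring.
    have ge i j : (N <= i)%N -> (N <= (i + j).+1)%N.
      by move=> Ni; rewrite (leq_trans Ni)// -addnS leq_addr.
    have rd i j : b i - b j \is Num.real.
      by rewrite realB// ger0_real// (le_trans ler01).
    rewrite mulr2n mulrDl mul1r lerD//.
      by rewrite (le_trans (real_ler_norm (rd _ _)))// H ?ge.
    by rewrite (le_trans (real_ler_norm (rd _ _)))// H ?ge.
  have : `|(h 0%N ** (u n - u m)) y| ^+ 2 <= (lam * e) ^+ 2.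
    rewrite (le_trans (conv_norm_le _ _ _))//.
    rewrite (le_trans (ler_wpM2l (nrm2_ge0 _) nrm))// /d.
    by rewrite le_eqVlt; apply/orP; left; apply/eqP; field; rewrite gt_eqF.
  rewrite convDr convNr !hu -scalerBr cfunZE normrM (gtr0_norm lam0).
  have le0 : 0 <= lam * e by rewrite mulr_ge0// ltW.
  rewrite ler_pXn2r// ?nnegrE ?mulr_ge0// ?(ltW lam0)//.
  by rewrite ler_pM2l// cfunBE.
have [q uq] := unif_complete u_cauchy.
have uq' : unif_cvg u q.
  move=> e /uq[N H]; exists N.+1 => -[//|n] Nn; exact: H.
have hq : h 0%N ** q = lam *: q.
  have := unif_cvg_conv (h 0%N) uq'.
  have -> : (fun n => h 0%N ** u n) = (fun n => lam *: u n.+1) by apply/funext.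
  by move=> /unif_cvg_unique; apply; exact: unif_cvgZ.
have hnq n : h n ** q = lam ^+ n.+1 *: q.
  elim: n => [|n IH]; first by rewrite expr1.
  by rewrite -[n]add0n -h_conv -convA add0n IH convZr hq scalerA -exprSr.
have uqE n : u n ** q = q.
  by rewrite convZl hnq scalerA mulVf ?scale1r.
exists lam, q; split => //.
- apply/negP => /eqP q0.
  have h20 : 0 < 2^-1 :> C by rewrite invr_gt0.
  have [N /(_ N (leqnn N) 1%g)] := uq' _ h20.
  rewrite q0 cfun0E subr0 uE => /(le_trans (real_ler_norm _)).
  rewrite ger0_real ?(le_trans ler01)// => /(_ isT) /(le_trans (b_ge1 N)).
  by rewrite lt_geF// invf_lt1// ltr1n.
- apply: (unif_cvg_unique _ uq'); have := unif_cvg_star uq'.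
  by have -> : (fun n => star (u n)) = u by apply/funext.
- apply: (unif_cvg_unique (unif_cvg_conv q uq')).
  have -> : (fun n => q ** u n) = fun=> q by apply/funext => n; rewrite convC.
  exact: unif_cvg_cst.
Qed.
End PowerMethod.

(** * Minimal idempotents and characters *)

Definition idem q := [/\ star q = q, q ** q = q & q != 0].

Lemma idem_nrm2 q : idem q -> nrm2 q = q 1%g.
Proof. by move=> [qs qq _]; rewrite /nrm2 qs qq. Qed.

Lemma idem_gt0 q : idem q -> 0 < q 1%g.
Proof.
by move=> iq; rewrite -idem_nrm2// lt_def nrm2_ge0 nrm2_eq0; case: iq => _ _ ->.
Qed.

Lemma idem_le q y : idem q -> `|q y| <= q 1%g.
Proof.
move=> iq; have q0 := ltW (idem_gt0 iq); have [qs qq _] := iq.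
rewrite -(@ler_pXn2r _ 2)// ?nnegrE//.
by have := conv_norm_le q q y; rewrite qq idem_nrm2// expr2.
Qed.

(** The value at 1 is the dimension of the ideal generated by q; the lower bound
    comes from q 1 = nrm2 q, the mean of |q| ^+ 2, which is at most (q 1) ^+ 2. *)
Lemma idem_ge1 q : idem q -> 1 <= q 1%g.
Proof.
move=> iq; have q0 := idem_gt0 iq.
rewrite -(ler_pM2r q0) mul1r -[X in X <= _]idem_nrm2// nrm2E.
rewrite -[X in X <= _]ger0_norm; last by rewrite -nrm2E nrm2_ge0.
apply: (mean_norm_le HM) => x.
by rewrite normrM norm_conjC ler_pM// idem_le.
Qed.

Definition minimal_idem p :=
  idem p /\ forall q, idem q -> p ** q = q -> q = p.

(** Passing to a strictly smaller idempotent p lowers the value at 1 by at least 1,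
    since q - p is an idempotent too; so the descent stops. *)
Lemma minimal_idem_exists q : idem q -> exists2 p, minimal_idem p & q ** p = p.
Proof.
move=> iq; have [n] := nat_bound C_lub (ltW (idem_gt0 iq)).
elim: n q iq => [|n IH] q iq qn.
  by have := lt_le_trans (idem_gt0 iq) qn; rewrite ltxx.
have [?|/existsNP[p /not_implyP[ip /not_implyP[qp /eqP pq]]]] :=
    pselect (forall p, idem p -> q ** p = p -> p = q).
  by exists q => //; have [_ qq _] := iq.
have [qs qq _] := iq; have [ps pp _] := ip.
have iqp : idem (q - p).
  split; first by rewrite starD starN qs ps.
    rewrite convDl convNl !convDr !convNr qq pp (convC p) qp.
    by rewrite opprB addrA subrK.
  by rewrite subr_eq0 eq_sym.
have [|r mr pr] := IH p ip.
  have := idem_ge1 iqp; rewrite cfunBE -(lerD2r (p 1%g)) subrK => /le_trans.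
  by move=> /(_ _ qn); rewrite -natr1 addrC lerD2r.
by exists r; rewrite // -pr convA qp.
Qed.

(** By minimality the spectral projection of any nonzero self-adjoint f of the
    ideal of p is p itself, whence f * f is a multiple of p. Applied to k and to
    k + p, this makes 2 k = (k + p) * (k + p) - k * k - p a multiple of p. *)
Lemma minimal_idem_selfadj p k : minimal_idem p -> star k = k -> p ** k = k ->
  exists a, k = a *: p.
Proof.
move=> [ip pmin]; have [ps pp p0] := ip.
have sq f : star f = f -> p ** f = f -> exists a, f ** f = a *: p.
  move=> fs pf; have [->|f0] := eqVneq f 0.
    by exists 0; rewrite conv0 scale0r.
  have [lam [q [lam0 q0 qs qq ffq]]] := power_method fs f0.
  have qE : q = lam^-1 *: (f ** f ** q).
    by rewrite ffq scalerA mulVf ?scale1r// gt_eqF.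
  have pq : p ** q = q by rewrite {1}qE convZr !convA pf -qE.
  exists lam; move: ffq; rewrite (pmin q)// => <-.
  by rewrite -convA (convC f p) pf.
move=> ks pk; have [a kk] := sq k ks pk.
have [||b] := sq (k + p).
- by rewrite starD ks ps.
- by rewrite convDr pk pp.
rewrite convDl !convDr kk pp (convC k p) pk => kb.
exists ((b - a - 1) / 2); apply: cfunP => x.
have := congr1 (fun f : A => f x) kb.
rewrite !(cfunDE, cfunZE) => kbx.
have -> : (b - a - 1) / 2 * p x = (b * p x - a * p x - p x) / 2 by field.
by rewrite -kbx; field.
Qed.

(** A translate of p lies in the ideal of p; split it into its self-adjoint real
    and imaginary parts. *)
Lemma minimal_idem_translate p y : minimal_idem p ->
  exists a, translate y p = a *: p.
Proof.
move=> mp; have [[ps pp _] _] := mp.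
set f := translate y p; pose g := translate y^-1%g p.
have fs : star f = g by rewrite star_translate ps.
have gs : star g = f by rewrite -fs starK.
have pf : p ** f = f by rewrite -translate_conv pp.
have pg : p ** g = g by rewrite -translate_conv pp.
have [||a fg] := @minimal_idem_selfadj p (f + g) mp.
- by rewrite starD fs gs addrC.
- by rewrite convDr pf pg.
have [||b fg'] := @minimal_idem_selfadj p ('i *: (f - g)) mp.
- by rewrite starZ starD starN fs gs conjCi scaleNr -scalerN opprB.
- by rewrite convZr convDr convNr pf pg.
exists ((a - 'i * b) / 2).
have -> : f = 2^-1 *: ((f + g) + (f - g)).
  rewrite addrACA subrr addr0 -mulr2n -[f *+ 2]scaler_nat.
  by rewrite scalerA mulVf ?scale1r// pnatr_eq0.
have -> : f - g = - 'i *: ('i *: (f - g)).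
  by rewrite scalerA mulNr -expr2 sqrCi opprK scale1r.
by rewrite fg fg' scalerA -scalerDl scalerA mulrC mulNr.
Qed.

(** The translation eigenvalues of p form a character, which is p normalised at 1.
    It has modulus at most 1 because p is largest at 1, and modulus 1 because the
    same bound holds at inverses. *)
Lemma minimal_idem_character p (phi : G -> C) : minimal_idem p ->
  (forall y, phi y = p y / p 1%g) ->
  [/\ continuous (phi : G -> C^o), forall y, `|phi y| = 1,
      forall x y, phi (x * y)%g = phi x * phi y
    & forall y, translate y p = phi y *: p].
Proof.
move=> mp phiE; have [ip _] := mp.
have p1 : p 1%g != 0 by rewrite gt_eqF// idem_gt0.
have tr y : translate y p = phi y *: p.
  have [a tra] := minimal_idem_translate y mp; rewrite tra phiE.
  have := congr1 (fun f : A => f 1%g) tra.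
  by rewrite translateE mulg1 cfunZE => ->; rewrite mulfK.
have phiM x y : phi (x * y)%g = phi x * phi y.
  have := congr1 (fun f : A => f y) (tr x).
  by rewrite translateE cfunZE [phi (_ * _)%g]phiE => ->; rewrite (phiE y) mulrA.
have phi_le y : `|phi y| <= 1.
  rewrite phiE normrM normfV ler_pdivrMr ?normr_gt0// mul1r.
  by rewrite [X in _ <= X]ger0_norm ?idem_le// ltW// idem_gt0.
have phi1 : phi 1%g = 1 by rewrite phiE divff.
split => //.
  have -> : phi = (p 1%g)^-1 *: p :> (G -> C) by apply/funext => y; rewrite phiE mulrC.
  exact: cfun_cts.
move=> y; apply/eqP; rewrite eq_le phi_le /=.
have : `|phi y| * `|phi y^-1%g| = 1 by rewrite -normrM -phiM mulgV phi1 normr1.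
move=> H; rewrite -[X in X <= _]H ler_piMr//.
Qed.

(** The idempotent p is taken below an eigenvalue lam != 0 of k * k, where
    k = d * star d and d = f - translate z f. If the character of p were trivial
    at z, then p would be invariant under z, so d * p = 0, contradicting
    k * k * p = lam p. *)
Lemma character_separates z f : translate z f <> f ->
  exists phi : G -> C^o, [/\ continuous phi, forall y, `|phi y| = 1,
    forall x y, phi (x * y)%g = phi x * phi y & phi z != 1].
Proof.
move=> zf; pose d := f - translate z f.
have d0 : d != 0 by rewrite subr_eq0; apply/eqP => /esym.
pose k := d ** star d.
have ks : star k = k by rewrite star_conv starK convC.
have k0 : k != 0.
  apply/negP => /eqP kE; move: d0; rewrite -nrm2_eq0 /nrm2 -/k kE.
  by rewrite cfun0E eqxx.
have [lam [q [lam0 q0 qs qq kkq]]] := power_method ks k0.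
have [p mp qp] := minimal_idem_exists (And3 qs qq q0).
have [ip _] := mp; have [_ _ p0] := ip.
exists (fun y => p y / p 1%g).
have [cphi n1 phiM tr] := minimal_idem_character mp (fun y => erefl (p y / p 1%g)).
split=> //; apply/negP => /eqP phig.
have : k ** k ** p = lam *: p by rewrite -qp convA kkq convZl.
have dp : d ** p = 0.
  rewrite convDl convNl (convC (translate z f)) -translate_conv (convC p).
  by rewrite translate_conv tr phig scale1r subrr.
have kp : k ** p = 0 by rewrite /k (convC d (star d)) -convA dp conv0.
rewrite -(convA k k p) kp conv0.
by move=> /esym/eqP; rewrite scaler_eq0 gt_eqF//= (negbTE p0).
Qed.

End ConvolutionAlgebra.

(** * Completeness of the complex numbers *)

Section ComplexNumbers.
Context (R : realType).

Lemma complex_order_complete : order_complete R[i].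
Proof.
move=> u uS [B uB].
have uI n : complex.Im (u n) = complex.Im (u 0%N).
  elim: n => // n <-; have := uS n; by rewrite lecE => /andP[/eqP].
pose S := range (fun n => complex.Re (u n)).
have Sub : has_sup S.
  split; first by exists (complex.Re (u 0%N)); exists 0%N.
  exists (complex.Re B) => _ [n _ <-].
  by have := uB n; rewrite lecE => /andP[].
exists (sup S +i* complex.Im (u 0%N))%C; split.
  move=> n; rewrite lecE/= (uI n); apply/andP; split=> //.
  by apply: ub_le_sup; [case: Sub|exists n].
move=> B' uB'; rewrite lecE/=; apply/andP; split.
  by have := uB' 0%N; rewrite lecE => /andP[].
apply: ge_sup => [|_ [n _ <-]]; first by case: Sub.
by have := uB' n; rewrite lecE => /andP[].
Qed.

Lemma real_seq_complete (v : nat -> R) :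
  (forall e, 0 < e -> exists N, forall n m, (N <= n)%N -> (N <= m)%N ->
    `|v n - v m| <= e) ->
  exists l, forall e, 0 < e -> exists N, forall n, (N <= n)%N -> `|v n - l| <= e.
Proof.
move=> vC.
have : cvg (v @ \oo).
  apply/cauchy_cvgP/cauchy_exP => e e0.
  have e20 : 0 < e / 2 by rewrite divr_gt0.
  have [N H] := vC _ e20.
  exists (v N); exists N => //= n Nn.
  rewrite /ball /= (le_lt_trans (H _ _ (leqnn N) Nn))//.
  by rewrite ltr_pdivrMr// ltr_pMr// ltr1n.
move=> /cvg_ex[l vl]; exists l => e e0.
have /cvgrPdist_le /(_ e e0)[N _ H] := vl.
by exists N => n Nn; rewrite distrC; exact: H.
Qed.

Lemma complex_norm_le (a b e : R) : `|a| <= e -> `|b| <= e ->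
  `|(a +i* b)%C| <= (2 * e)%:C%C.
Proof.
move=> ae be; rewrite normc_def lecR/=.
have e0 : 0 <= e by apply: le_trans ae.
rewrite -[2 * e]ger0_norm ?mulr_ge0// -sqrtr_sqr ler_wsqrtr//.
have : a ^+ 2 <= e ^+ 2 by rewrite -(real_normK (num_real a)) ler_pXn2r// nnegrE.
have : b ^+ 2 <= e ^+ 2 by rewrite -(real_normK (num_real b)) ler_pXn2r// nnegrE.
nra.
Qed.

Lemma complex_cauchy_complete (u : nat -> R[i]) :
  seq_cauchy u -> exists l, seq_cvg u l.
Proof.
move=> uC.
have toR (e : R[i]) : 0 < e -> 0 < complex.Re e /\ e = (complex.Re e)%:C%C.
  case: e => a b; rewrite ltcE/= => /andP[/eqP -> a0]; split=> //.
have ImE (z : R[i]) : `|complex.Im z|%:C%C <= `|z|.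
  by rewrite normc_def lecR -sqrtr_sqr ler_wsqrtr// lerDr sqr_ge0.
have eC (e : R) : 0 < e -> 0 < e%:C%C by rewrite ltcR.
have [a ua] : exists l, forall e, 0 < e -> exists N, forall n, (N <= n)%N ->
    `|complex.Re (u n) - l| <= e.
  apply: real_seq_complete => e /eC/uC[N H]; exists N => n m Nn Nm.
  rewrite -lecR; apply: le_trans (H n m Nn Nm).
  by have := normc_ge_Re (u n - u m); case: (u n) (u m) => ? ? [].
have [b ub] : exists l, forall e, 0 < e -> exists N, forall n, (N <= n)%N ->
    `|complex.Im (u n) - l| <= e.
  apply: real_seq_complete => e /eC/uC[N H]; exists N => n m Nn Nm.
  rewrite -lecR; apply: le_trans (H n m Nn Nm).
  by have := ImE (u n - u m); case: (u n) (u m) => ? ? [].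
exists (a +i* b)%C => e /toR[e0 ->].
have e20 : 0 < complex.Re e / 2 by rewrite divr_gt0.
have [N H] := ua _ e20; have [N' H'] := ub _ e20.
exists (maxn N N') => n; rewrite geq_max => /andP[/H + /H'].
case: (u n) => c d /= ca db.
have -> : complex.Re e = 2 * (complex.Re e / 2) by rewrite mulrC divfK.
exact: complex_norm_le.
Qed.

Lemma real_complex_continuous (T : topologicalType) (f : T -> R) :
  continuous f -> continuous ((fun x => (f x)%:C%C) : T -> R[i]^o).
Proof.
move=> cf x; apply/cvgrPdist_le => -[e e']; rewrite ltcE/= => /andP[/eqP -> e0].
have /cvgrPdist_le /(_ e e0) := cf x; apply: filterS => y fxy.
by rewrite -rmorphB normc_def/= expr0n/= addr0 sqrtr_sqr lecR.
Qed.
End ComplexNumbers.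

(** * Characters of compact abelian groups *)

(** A function with f 1 = 0 and f g = 1, provided by Urysohn's lemma, is not
    invariant under g. *)
Theorem compact_abelian_characters_separate (R : realType)
    (G : topologicalGroupType) : compact [set: G] -> hausdorff_space G ->
  commutative (@monoid.mul G) -> forall g : G, g != 1%g ->
  exists2 phi : G -> R[i]^o, character_group R[i] G phi & phi g != 1.
Proof.
move=> cG hG GC g g1.
have [M HM] := @complex_invariant_mean R G GC.
have sep : exists f : cfun R[i] G, translate g f <> f.
  have cl := accessible_closed_set1 (hausdorff_accessible hG).
  have dis : [set 1%g] `&` [set g] = set0.
    by apply/seteqP; split=> // x [/= ->] /esym/eqP; rewrite (negbTE g1).
  have usep := (@normal_separatorP R G).1 (compact_normal hG cG) _ _ (cl _) (cl _) dis.
  have [f [cf _ f0 f1]] := (uniform_separatorP (R := R) _ _).1 usep.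
  exists (mkcfun (real_complex_continuous cf)) => H.
  have := congr1 (fun h : cfun R[i] G => h 1%g) H.
  rewrite /= mulg1 (_ : f g = 1); last by apply: f1; exists g.
  rewrite (_ : f 1%g = 0); last by apply: f0; exists 1%g.
  by move=> /eqP; rewrite oner_eq0.
have [f zf] := sep.
have [phi [c n m pg]] := character_separates cG GC HM
  (@complex_order_complete R) (@complex_cauchy_complete R) zf.
by exists phi.
Qed.

(** * One-dimensional representations and sections *)

Section CharacterRepresentation.
Context (K : numFieldType) (G : topologicalGroupType) (phi : G -> K^o).
Context (phi_char : character_group K G phi).

Let phi_cts : continuous phi. Proof. by case: phi_char. Qed.
Let phiM g h : phi (g * h)%g = phi g * phi h. Proof. by case: phi_char. Qed.

Lemma character1 : phi 1%g = 1.
Proof.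
have n0 : phi 1%g != 0 by rewrite -normr_eq0; case: phi_char => _ -> _; exact: oner_neq0.
by apply: (mulfI n0); rewrite -phiM mulg1 mulr1.
Qed.

Definition character_act (g : G) : {linear K^o -> K^o} := *:%R (phi g).

Fact character_act1 v : character_act 1%g v = v.
Proof. by rewrite /character_act/= character1 scale1r. Qed.

Fact character_actM g h v :
  character_act (g * h)%g v = character_act g (character_act h v).
Proof. by rewrite /character_act/= phiM scalerA. Qed.

Fact character_act_continuous :
  continuous (fun x : G * K^o => character_act x.1 x.2).
Proof.
move=> x; apply: (@cvgM K _ _ _ (fun x : G * K^o => phi x.1) snd); last exact: cvg_snd.
by apply: (@continuous_comp _ _ _ fst phi); [exact: cvg_fst|exact: phi_cts].
Qed.

Definition character_rep : representation K G :=
  Representation (@norm_hausdorff K K^o) character_act1 character_actM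
    character_act_continuous.
End CharacterRepresentation.

Lemma character_inv (K : numFieldType) (G : topologicalGroupType) (phi : G -> K^o) :
  commutative (@monoid.mul G) -> character_group K G phi ->
  character_group K G (fun g => phi g^-1%g).
Proof.
move=> GC [cphi nphi phiM]; split=> // [|g h].
  move=> x; apply: (@continuous_comp _ _ _ (fun g : G => g^-1%g) phi).
    exact: invg_continuous.
  exact: cphi.
by rewrite invgM GC phiM.
Qed.

Section TensorOfLinear.
Context (K : numFieldType) (U V U' V' : lmodType K).

Lemma tensor_mapE (f : {linear U -> U'}) (h : {linear V -> V'}) u v :
  tensor_map f h (tpure u v) = tpure (f u) (h v).
Proof.
rewrite /tensor_map tensor_liftE// => [w|w] a x y.
  by rewrite linearP tpureDl tpureZl.
by rewrite linearP tpureDr tpureZr.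
Qed.
End TensorOfLinear.

Lemma tensor_evalE (K : numFieldType) (A : locallyConvexAlgType K)
    (V : lmodType K) (chi : {scalar A}) (a : A) (v : V) :
  tensor_eval chi (tpure a v) = chi a *: v.
Proof.
rewrite /tensor_eval tensor_liftE// => [w|b] c x y.
  by rewrite linearP scalerDl scalerA.
by rewrite scalerDr !scalerA mulrC.
Qed.

Theorem proposition5p3 (R : realType) (A : locallyConvexAlgType R[i])
    (G : topologicalGroupType)
    (A_comm : forall a b : A, a * b = b * a)
    (G_compact : compact [set: G]) (G_hausdorff : hausdorff_space G)
    (G_abelian : forall g h : G, (g * h)%g = (h * g)%g)
    (alpha : dynamical_system A G)
    (ev_surj : forall (phi : G -> R[i]^o) (chi : {scalar A}),
       character_group R[i] G phi -> spectrum A chi ->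
       set_surj (isotypic alpha phi) [set: R[i]] chi) :
  free_system alpha.
Proof.
exists {phi : G -> R[i]^o | character_group R[i] G phi}.
exists (fun phi => character_rep (svalP phi)); split.
  move=> g /(compact_abelian_characters_separate R G_compact G_hausdorff G_abelian).
  move=> [phi phiC phig]; exists (exist _ phi phiC), 1 => /=.
  by rewrite /character_act/= => /eqP; rewrite [_ *: _]mulr1 (negbTE phig).
move=> [phi phiC] chi chiS z _ /=.
(* the section a (x) 1 is invariant when a has the inverse weight of phi *)
have [a aphi az] := ev_surj _ _ (character_inv G_abelian phiC) chiS z I.
exists (tpure a (1 : R[i]^o)); last by rewrite tensor_evalE az [_ *: _]mulr1.
move=> g; rewrite tensor_mapE /= (aphi g) tpureZl tpureZr scalerA.
have [_ _ phiM] := phiC.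
by rewrite -phiM mulVg character1// scale1r.
Qed.
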